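(* Let $\gamma>0$, let $V\in C_{p,\gamma}^{0}(\mathbb{R})$ and let $W$ be a continuous $\gamma$-periodic (possibly complex-valued) function, and set $\mathscr{L}\psi:=-\psi''+W\psi'+V\psi$ and $\bar{W}:=\frac{1}{\gamma}\int_{0}^{\gamma}W(s)\,ds$. If $\lambda\in\sigma_{g}^{1}(\mathscr{L})\cup\sigma_{g}^{2}(\mathscr{L})$, then $$\mathcal{A}(\lambda)=\{[\tfrac{1}{2\mathrm{i}}\bar{W}]_{\gamma}\}\quad\text{or}\quad\mathcal{A}(\lambda)=\{[\tfrac{1}{2\mathrm{i}}\bar{W}+\tfrac{\pi}{\gamma}]_{\gamma}\}.$$ If $\lambda\in\sigma_{g}^{3}(\mathscr{L})$, then $\mathcal{A}(\lambda)=\{[k_{1}]_{\gamma},[k_{2}]_{\gamma}\}$ with $[k_{1}+k_{2}]_{\gamma}=[\tfrac{1}{\mathrm{i}}\bar{W}]_{\gamma}$.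
   Context: $C_{p}^{0}(I)$: integrable piecewise-continuous functions on $I$ (finitely many discontinuities on each finite subinterval, one-sided improper integrals of $|f|$ converging at each discontinuity); $C_{p}^{l}(I)$: differentiable functions with derivative in $C_{p}^{l-1}(I)$; $C_{p,\gamma}^{l}(\mathbb{R})$: $\gamma$-periodic functions in $C_{p}^{l}(\mathbb{R})$; $[k]_{\gamma}=\{k+2m\pi/\gamma:m\in\mathbb{Z}\}$. Every solution in $C_p^2(\mathbb{R})$ of $\mathscr{L}\psi=\lambda\psi$ ($\lambda\in\mathbb{R}$) has one of the forms (a) $e^{\mathrm{i}k_0x}p(x)$, (b) $e^{\mathrm{i}k_0x}(p_1(x)+xp_2(x))$ with $p_2\not\equiv0$, (c) $e^{\mathrm{i}k_1x}p_1(x)+e^{\mathrm{i}k_2x}p_2(x)$ with $[k_1]_\gamma\ne[k_2]_\gamma$, where $k_j\in\mathbb{C}$ and $p,p_1,p_2\in C^2_{p,\gamma}(\mathbb{R})$; the exponents $k$ are called quasimomenta, and $\mathcal{A}(\lambda)$ is the set of congruence classes modulo $2\pi/\gamma$ of quasimomenta of solutions for $\lambda$. $\sigma_{g}^{1}(\mathscr{L})$, $\sigma_{g}^{2}(\mathscr{L})$, $\sigma_{g}^{3}(\mathscr{L})$ are the sets of $\lambda\in\mathbb{R}$ for which there is a solution of form (a) with $|\mathcal{A}(\lambda)|=1$, of form (b) with $|\mathcal{A}(\lambda)|=1$, and of form (c) with $|\mathcal{A}(\lambda)|=2$, respectively.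
   Formalization: ''Differentiable'' in C_p^l is read as continuous and differentiable off finitely many points of each bounded interval; with differentiability everywhere the claim fails (W=0, γ=1, V(x)=x on [0,1) periodic, λ a Dirichlet eigenvalue). Periodic factors p, p_1, p_2 in (a), (c) are taken nonzero. *)

(* Defs.v *)
From Stdlib Require Import Reals ZArith List.
From Coquelicot Require Import Coquelicot.
Set Implicit Arguments.
Open Scope R_scope.

Definition cexp (z : C) : C :=
  (exp (Re z) * cos (Im z), exp (Re z) * sin (Im z)).

Definition periodic (g : R) (f : R -> C) : Prop := forall x, f (x + g) = f x.

Definition Cp0 (f : R -> C) : Prop :=
  forall a b : R, a < b ->
  exists D : list R,
    (forall x, a <= x <= b -> ~ In x D -> continuous f x) /\
    (forall d, In d D ->
       exists eps, 0 < eps /\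
         ex_RInt_gen (fun x => Cmod (f x)) (at_right d) (at_point (d + eps)) /\
         ex_RInt_gen (fun x => Cmod (f x)) (at_point (d - eps)) (at_left d)).

Definition Cp1 (f g : R -> C) : Prop :=
  (forall x, continuous f x) /\
  (forall a b : R, a < b ->
     exists E : list R, forall x, a <= x <= b -> ~ In x E ->
       is_derive (V := C_R_NormedModule) f x (g x)) /\
  Cp0 g.

Definition Cp2 (f : R -> C) : Prop :=
  exists f1 f2 : R -> C, Cp1 f f1 /\ Cp1 f1 f2.

Definition Cp2per (g : R) (f : R -> C) : Prop := periodic g f /\ Cp2 f.

Definition is_sol (V W : R -> C) (lam : R) (psi : R -> C) : Prop :=
  exists psi1 psi2 : R -> C,
    Cp1 psi psi1 /\ Cp1 psi1 psi2 /\
    forall x, (- psi2 x + W x * psi1 x + V x * psi x = RtoC lam * psi x)%C.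

Definition nonzero (f : R -> C) : Prop := exists x, f x <> RtoC 0.

Definition ekx (k : C) (x : R) : C := cexp (Ci * k * RtoC x)%C.

Definition congr (g : R) (k1 k2 : C) : Prop :=
  exists m : Z, k1 = (k2 + RtoC (2 * IZR m * PI / g))%C.

Definition form_a (g : R) (psi : R -> C) (k0 : C) : Prop :=
  exists p, Cp2per g p /\ nonzero p /\ forall x, psi x = (ekx k0 x * p x)%C.

Definition form_b (g : R) (psi : R -> C) (k0 : C) : Prop :=
  exists p1 p2, Cp2per g p1 /\ Cp2per g p2 /\ nonzero p2 /\
    forall x, psi x = (ekx k0 x * (p1 x + RtoC x * p2 x))%C.

Definition form_c (g : R) (psi : R -> C) (k1 k2 : C) : Prop :=
  exists p1 p2, Cp2per g p1 /\ Cp2per g p2 /\ nonzero p1 /\ nonzero p2 /\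
    ~ congr g k1 k2 /\
    forall x, psi x = (ekx k1 x * p1 x + ekx k2 x * p2 x)%C.

Definition quasimom (g : R) (V W : R -> C) (lam : R) (k : C) : Prop :=
  exists psi, is_sol V W lam psi /\
    (form_a g psi k \/ form_b g psi k \/
     exists k', form_c g psi k k' \/ form_c g psi k' k).

(* |A(lam)| = 1  and  |A(lam)| = 2 (A(lam) = set of classes of quasimomenta) *)
Definition card_A_1 g V W lam : Prop :=
  exists k, quasimom g V W lam k /\
    forall k', quasimom g V W lam k' -> congr g k' k.

Definition card_A_2 g V W lam : Prop :=
  exists k1 k2, ~ congr g k1 k2 /\
    quasimom g V W lam k1 /\ quasimom g V W lam k2 /\
    forall k', quasimom g V W lam k' -> congr g k' k1 \/ congr g k' k2.

Definition sigma_g1 g V W (lam : R) : Prop :=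
  (exists psi k0, is_sol V W lam psi /\ form_a g psi k0) /\ card_A_1 g V W lam.
Definition sigma_g2 g V W (lam : R) : Prop :=
  (exists psi k0, is_sol V W lam psi /\ form_b g psi k0) /\ card_A_1 g V W lam.
Definition sigma_g3 g V W (lam : R) : Prop :=
  (exists psi k1 k2, is_sol V W lam psi /\ form_c g psi k1 k2) /\
  card_A_2 g V W lam.

Definition A_is_class g V W lam (c : C) : Prop :=
  forall k, quasimom g V W lam k <-> congr g k c.

Definition Wbar (g : R) (W : R -> C) : C :=
  (RtoC (/ g) * RInt (V := C_R_CompleteNormedModule) W 0 g)%C.

(* Main.v *)
(** A class [k] is a quasimomentum exactly when [exp (i k g)] is a Floquet multiplier, that is,
    when some nonzero solution satisfies [y (x + g) = exp (i k g) y x].  The Wronskian of two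
    solutions satisfies [w' = W w], so [w g = w 0 exp (g Wbar)]: the monodromy matrix has
    determinant [exp (g Wbar)].  Two distinct multipliers therefore have product [exp (g Wbar)],
    and a single one has square [exp (g Wbar)]; taking logarithms gives the quasimomenta.  The
    case of a single multiplier needs a second independent solution, obtained from the given one
    by reduction of order, so only integration is used and no existence theorem for
    differential equations. *)

Require Import Defs.
From Stdlib Require Import Reals ZArith List.
From Coquelicot Require Import Coquelicot.
From Stdlib Require Import Lra ClassicalEpsilon.
Open Scope R_scope.

(** * Antiderivatives with locally finitely many exceptional points *)

(** The potential may be unbounded near its discontinuities, so the equation can be differentiated
    and integrated only off a locally finite set, and the standard calculus theorems do not apply
    across the exceptional points. Every analytic fact is therefore phrased through primitives: a
    continuous [F] whose derivative is [f] in a punctured neighbourhood of each point. A continuous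
    function whose derivative vanishes off such a set is still constant, and one whose derivative is
    nonnegative there is still monotone; this carries uniqueness, Liouville's formula and the
    patching of local antiderivatives.

    Knowing a single class does not by itself involve the determinant. The link is the second
    diagonal entry [d] of the triangular monodromy: were it different from the multiplier, it would
    be an eigenvalue too and give a second class. Hence both entries agree and the determinant is a
    square. The two candidate classes are its two square roots, told apart by the parity of the
    integer in the logarithm. *)

(** The supremum of the endpoints reached from [a] is itself reached and cannot stop before [b].
    Asking the local property only for intervals that contain [x] is what allows [x] to be an
    exceptional point. *)
Lemma cousin (P : R -> R -> Prop) :
  (forall a b c, a <= b -> b <= c -> P a b -> P b c -> P a c) ->
  (forall x, exists d, 0 < d /\
     forall u v, x - d < u -> u <= x -> x <= v -> v < x + d -> P u v) ->
  forall a b, a <= b -> P a b.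
Proof.
intros Hadd Hloc a b Hab.
destruct (completeness (fun t => a <= t <= b /\ P a t)) as [s [Hub Hlub]].
- exists b; intros t [Ht _]; lra.
- exists a; split; [lra|].
  destruct (Hloc a) as [d [Hd H]]; apply H; lra.
- assert (Has : a <= s).
  { apply Hub; split; [lra|].
    destruct (Hloc a) as [d [Hd H]]; apply H; lra. }
  assert (Hsb : s <= b) by (apply Hlub; intros t [Ht _]; lra).
  destruct (Hloc s) as [d [Hd H]].
  assert (Ht : exists t, s - d < t <= s /\ a <= t /\ P a t).
  { apply Classical_Prop.NNPP; intros Hn.
    assert (s <= s - d); [|lra].
    apply Hlub; intros t [Ht HP].
    destruct (Rle_or_lt t (s - d)) as [|Hlt]; [assumption|].
    exfalso; apply Hn; exists t; repeat split; try lra; try assumption.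
    apply Hub; split; assumption. }
  destruct Ht as [t [[Ht1 Ht2] [Hat HP]]].
  destruct (Rle_or_lt b (s + d / 2)) as [Hb|Hb].
  + apply Hadd with t; try lra; try assumption.
    apply H; lra.
  + assert (s + d / 2 <= s); [|lra].
    apply Hub; split; [lra|].
    apply Hadd with t; try lra; try assumption.
    apply H; lra.
Qed.

Lemma locally'_sides (x : R) (P : R -> Prop) :
  locally' x P <-> at_left x P /\ at_right x P.
Proof.
split.
- intros H; split; revert H; unfold locally', at_left, at_right, within;
    apply filter_imp; intros y Hy Hyx; apply Hy; lra.
- intros [H1 H2]; generalize (filter_and (F := locally x) _ _ H1 H2).
  unfold locally', within; apply filter_imp.
  intros y [Hl Hr] Hyx.
  destruct (Rtotal_order y x) as [H|[H|H]]; [now apply Hl|easy|now apply Hr].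
Qed.

Lemma locally'_ball (x : R) (P : R -> Prop) :
  locally' x P <-> exists d, 0 < d /\ forall y, x - d < y < x + d -> y <> x -> P y.
Proof.
split.
- intros [d Hd]; exists d; split; [apply cond_pos|].
  intros y Hy Hyx; apply Hd; [|assumption].
  apply Rabs_def1; unfold minus, plus, opp; simpl; lra.
- intros [d [Hd H]]; exists (mkposreal d Hd); intros y Hy Hyx; apply H; [|assumption].
  apply Rabs_def2 in Hy; unfold minus, plus, opp in Hy; simpl in Hy; lra.
Qed.

Lemma locally_open_interval (p q y : R) (P : R -> Prop) :
  p < y < q -> (forall z, p < z < q -> P z) -> locally y P.
Proof.
intros Hy H.
assert (Hd : 0 < Rmin (y - p) (q - y)) by (apply Rmin_pos; lra).
exists (mkposreal _ Hd); intros z Hz.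
apply Rabs_def2 in Hz; unfold minus, plus, opp in Hz; simpl in Hz.
generalize (Rmin_l (y - p) (q - y)), (Rmin_r (y - p) (q - y)); intros.
apply H; lra.
Qed.

(** Since both one-sided limits exist, subtracting them makes the two branches tend to 0 at [x], and
    the value 0 there joins them continuously. *)
Lemma glue_at (A B : R -> R) (x lA lB : R) (a : R -> R) :
  filterlim A (at_right x) (locally lA) ->
  filterlim B (at_left x) (locally lB) ->
  at_right x (fun y => is_derive A y (a y)) ->
  at_left x (fun y => is_derive B y (a y)) ->
  exists F, continuous F x /\ locally' x (fun y => is_derive F y (a y)).
Proof.
intros HA HB HA' HB'.
pose (F := fun t => if Rlt_dec t x then B t - lB
                    else if Rlt_dec x t then A t - lA else 0).
assert (FA : forall t, x < t -> F t = A t - lA).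
{ intros t Ht; unfold F; destruct (Rlt_dec t x); [lra|].
  destruct (Rlt_dec x t); [reflexivity|lra]. }
assert (FB : forall t, t < x -> F t = B t - lB).
{ intros t Ht; unfold F; destruct (Rlt_dec t x); [reflexivity|lra]. }
assert (F0 : F x = 0).
{ unfold F; destruct (Rlt_dec x x); lra. }
assert (Hlim : forall (S : (R -> Prop) -> Prop) (G : R -> R) (l : R), Filter S ->
  filterlim G S (locally l) -> S (fun t => F t = G t - l) ->
  filterlim F S (locally (F x))).
{ intros S G l HS HG HE; rewrite F0.
  apply filterlim_ext_loc with (fun t => plus (G t) (opp l)).
  - revert HE; apply filter_imp; intros t ->; reflexivity.
  - replace 0 with (plus l (opp l)) by (unfold plus, opp; simpl; ring).
    eapply filterlim_comp_2; [exact HG|apply filterlim_const|].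
    apply (filterlim_plus (V := R_NormedModule)). }
exists F; split.
- apply continuity_pt_filterlim, continuity_pt_filterlim'.
  intros P HP; unfold filtermap; apply locally'_sides; split.
  + apply (Hlim (at_left x) B lB); try assumption; try apply _.
    exists (mkposreal 1 Rlt_0_1); intros y _ Hy; apply FB, Hy.
  + apply (Hlim (at_right x) A lA); try assumption; try apply _.
    exists (mkposreal 1 Rlt_0_1); intros y _ Hy; apply FA, Hy.
- apply locally'_sides; split.
  + revert HB'; unfold at_left, within; apply filter_imp; intros y Hy Hyx.
    apply is_derive_ext_loc with (fun t => B t - lB).
    * apply locally_open_interval with (y - 1) x; [lra|].
      intros z Hz; symmetry; apply FB; lra.
    * specialize (Hy Hyx); auto_derive; [now exists (a y)|].
      rewrite Rmult_1_l; now apply is_derive_unique.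
  + revert HA'; unfold at_right, within; apply filter_imp; intros y Hy Hyx.
    apply is_derive_ext_loc with (fun t => A t - lA).
    * apply locally_open_interval with x (y + 1); [lra|].
      intros z Hz; symmetry; apply FA; lra.
    * specialize (Hy Hyx); auto_derive; [now exists (a y)|].
      rewrite Rmult_1_l; now apply is_derive_unique.
Qed.

Lemma derive_nonneg_le (F f : R -> R) (a b : R) :
  a <= b -> (forall x, a <= x <= b -> is_derive F x (f x)) ->
  (forall x, a <= x <= b -> 0 <= f x) -> F a <= F b.
Proof.
intros Hab HF Hf.
destruct (MVT_gen F a b f) as [c [Hc E]].
- intros x; rewrite Rmin_left, Rmax_right by lra; intros Hx; apply HF; lra.
- intros x; rewrite Rmin_left, Rmax_right by lra; intros Hx.
  apply continuity_pt_filterlim, (ex_derive_continuous (V := R_NormedModule)).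
  exists (f x); apply HF; lra.
- rewrite Rmin_left, Rmax_right in Hc by lra.
  assert (0 <= f c * (b - a)); [|lra].
  apply Rmult_le_pos; [apply Hf; lra|lra].
Qed.

(** Increments of [G] are bounded by increments of [Phi], so the Cauchy criterion passes from [Phi]
    to [G]. The filter [S] stands for the approach to either end of the interval, where [f] may be
    unbounded. *)
Lemma antiderivative_limit (f phi Phi : R -> R) (p q : R) :
  p < q ->
  (forall y, p < y < q ->
     continuous f y /\ is_derive Phi y (phi y) /\ Rabs (f y) <= phi y) ->
  exists G, (forall y, p < y < q -> is_derive G y (f y)) /\
    forall S : (R -> Prop) -> Prop, ProperFilter S -> S (fun y => p < y < q) ->
      (exists l, filterlim Phi S (locally l)) ->
      exists l, filterlim G S (locally l).
Proof.
intros Hpq H.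
pose (m := (p + q) / 2).
pose (G := fun t => RInt f m t).
assert (HG : forall y, p < y < q -> is_derive G y (f y)).
{ intros y Hy; apply is_derive_RInt with m; [|now apply H].
  apply locally_open_interval with p q; [assumption|].
  intros z Hz; apply (RInt_correct (V := R_CompleteNormedModule)).
  apply (ex_RInt_continuous (V := R_CompleteNormedModule)).
  intros t Ht; apply H; revert Ht; unfold Rmin, Rmax, m.
  destruct (Rle_dec ((p + q) / 2) z); lra. }
assert (Hle : forall s t, p < s -> s <= t -> t < q -> Rabs (G t - G s) <= Phi t - Phi s).
{ intros s t Hs Hst Ht; apply Rabs_le; split.
  - assert (G s + Phi s <= G t + Phi t); [|lra].
    apply (derive_nonneg_le (fun y => G y + Phi y) (fun y => f y + phi y)); [lra| |].
    + intros y Hy; apply (is_derive_plus (V := R_NormedModule)); [apply HG|apply H]; lra.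
    + intros y Hy; destruct (H y) as [_ [_ Hf]]; [lra|].
      apply Rabs_le_between in Hf; lra.
  - assert (Phi s - G s <= Phi t - G t); [|lra].
    apply (derive_nonneg_le (fun y => Phi y - G y) (fun y => phi y - f y)); [lra| |].
    + intros y Hy; apply (is_derive_minus (V := R_NormedModule)); [apply H|apply HG]; lra.
    + intros y Hy; destruct (H y) as [_ [_ Hf]]; [lra|].
      apply Rabs_le_between in Hf; lra. }
exists G; split; [exact HG|].
intros S HS HSI HPhi.
apply (filterlim_locally_cauchy (U := R_CompleteSpace)).
intros eps.
destruct (proj2 (filterlim_locally_cauchy (U := R_CompleteSpace) Phi) HPhi eps) as [P [HP HPc]].
exists (fun y => P y /\ p < y < q); split; [now apply filter_and|].
intros u v [Hu Hu'] [Hv Hv'].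
assert (Hb := HPc u v Hu Hv).
change (Rabs (G v - G u) < eps); change (Rabs (Phi v - Phi u) < eps) in Hb.
destruct (Rle_or_lt u v) as [Huv|Huv].
- eapply Rle_lt_trans; [apply Hle; lra|].
  eapply Rle_lt_trans; [apply Rle_abs|exact Hb].
- rewrite Rabs_minus_sym; rewrite Rabs_minus_sym in Hb.
  eapply Rle_lt_trans; [apply Hle; lra|].
  eapply Rle_lt_trans; [apply Rle_abs|exact Hb].
Qed.

Lemma dominated_antiderivative_at (f phi Phi : R -> R) (x : R) :
  continuous Phi x ->
  locally' x (fun y =>
    continuous f y /\ is_derive Phi y (phi y) /\ Rabs (f y) <= phi y) ->
  exists F, continuous F x /\ locally' x (fun y => is_derive F y (f y)).
Proof.
intros HPhi H.
apply locally'_ball in H; destruct H as [d [Hd H]].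
assert (Hr : at_right x (fun y => x < y < x + d)).
{ exists (mkposreal d Hd); intros y Hy Hyx.
  apply Rabs_def2 in Hy; unfold minus, plus, opp in Hy; simpl in Hy; lra. }
assert (Hl : at_left x (fun y => x - d < y < x)).
{ exists (mkposreal d Hd); intros y Hy Hyx.
  apply Rabs_def2 in Hy; unfold minus, plus, opp in Hy; simpl in Hy; lra. }
destruct (antiderivative_limit f phi Phi x (x + d)) as [A [HA HAl]]; [lra| |].
{ intros y Hy; apply H; lra. }
destruct (antiderivative_limit f phi Phi (x - d) x) as [B [HB HBl]]; [lra| |].
{ intros y Hy; apply H; lra. }
destruct (HAl (at_right x)) as [lA HlA]; [apply _|exact Hr| |].
{ exists (Phi x); eapply filterlim_filter_le_1; [|exact HPhi].
  intros Q HQ; unfold at_right, within; revert HQ; apply filter_imp; auto. }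
destruct (HBl (at_left x)) as [lB HlB]; [apply _|exact Hl| |].
{ exists (Phi x); eapply filterlim_filter_le_1; [|exact HPhi].
  intros Q HQ; unfold at_left, within; revert HQ; apply filter_imp; auto. }
apply (glue_at A B x lA lB f HlA HlB).
- revert Hr; apply filter_imp; intros y Hy; now apply HA.
- revert Hl; apply filter_imp; intros y Hy; now apply HB.
Qed.

Lemma locally'_neq (x z : R) : locally' z (fun y => y <> x).
Proof.
destruct (Req_dec z x) as [->|Hzx].
- apply locally'_ball; exists 1; split; [lra|]; auto.
- apply locally'_ball; exists (Rabs (z - x)); split; [apply Rabs_pos_lt; lra|].
  intros y Hy _ ->; revert Hy; unfold Rabs; destruct (Rcase_abs (z - x)); lra.
Qed.

Lemma locally'_notin (D : list R) (z : R) : locally' z (fun y => ~ In y D).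
Proof.
induction D as [|x D IH].
- apply filter_forall; auto.
- generalize (filter_and _ _ (locally'_neq x z) IH); apply filter_imp.
  intros y [H1 H2] [H|H]; auto.
Qed.

Lemma locally'_near (z d : R) : 0 < d -> locally' z (fun y => z - d < y < z + d).
Proof. intros Hd; apply locally'_ball; exists d; auto. Qed.

(** [locally'] is the filter of punctured neighbourhoods. By compactness, finitely many exceptions
    on bounded intervals amount to none in some punctured neighbourhood of each point; in this form,
    unions of exceptional sets become [filter_and]. *)
Lemma locally_finite_exceptions (Q : R -> Prop) :
  (forall a b, a < b -> exists E : list R, forall x, a <= x <= b -> ~ In x E -> Q x) <->
  forall x, locally' x Q.
Proof.
split.
- intros H x; destruct (H (x - 1) (x + 1)) as [E HE]; [lra|].
  generalize (filter_and _ _ (locally'_near x 1 Rlt_0_1) (locally'_notin E x)).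
  apply filter_imp; intros y [Hy HyE]; apply HE; [lra|assumption].
- intros H a b Hab.
  apply (cousin (fun a b => exists E : list R, forall x, a <= x <= b -> ~ In x E -> Q x));
    [| |lra].
  + intros u v w _ _ [E1 H1] [E2 H2]; exists (E1 ++ E2); intros x Hx HxE.
    destruct (Rle_or_lt x v); [apply H1|apply H2]; try lra;
      intros Hi; apply HxE, in_or_app; auto.
  + intros x; destruct (proj1 (locally'_ball x Q) (H x)) as [d [Hd HQ]].
    exists d; split; [assumption|]; intros u v Hu _ _ Hv.
    exists (x :: nil); intros y Hy Hyx; apply HQ; [lra|].
    intros ->; apply Hyx; now left.
Qed.

Lemma punctured_derive_nonneg_le (F : R -> R) (a b : R) :
  (forall x, continuous F x) ->
  (forall x, locally' x (fun y => a < y < b -> exists l, 0 <= l /\ is_derive F y l)) ->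
  forall u v, a <= u -> u <= v -> v <= b -> F u <= F v.
Proof.
intros HF H u v Hau Huv Hvb.
revert Hau Hvb; pattern u, v; apply cousin; [| |assumption].
- intros x y z Hxy Hyz H1 H2 Hax Hzb; apply Rle_trans with (F y); [apply H1|apply H2]; lra.
- intros x; destruct (proj1 (locally'_ball x _) (H x)) as [d [Hd HQ]].
  assert (K : forall s t, a <= s -> s <= t -> t <= b -> x - d < s -> t < x + d ->
    (t <= x \/ x <= s) -> F s <= F t).
  { intros s t Has Hst Htb Hs Ht Hx.
    (* [MVT_gen] may return an endpoint, possibly the exceptional point [x], where nothing is known
       of [Derive]; the maximum with 0 keeps the sign there. *)
    destruct (MVT_gen F s t (fun y => Rmax 0 (Derive F y))) as [c [Hc E]].
    - intros y; rewrite Rmin_left, Rmax_right by lra; intros Hy.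
      destruct (HQ y) as [l [Hl Hl']]; try lra.
      rewrite (is_derive_unique _ _ _ Hl'), Rmax_right; assumption.
    - intros y _; apply continuity_pt_filterlim, HF.
    - assert (0 <= Rmax 0 (Derive F c) * (t - s)); [|lra].
      apply Rmult_le_pos; [apply Rmax_l|lra]. }
  exists d; split; [assumption|]; intros s t Hs Hsx Hxt Ht Has Htb.
  apply Rle_trans with (F x); apply K; lra.
Qed.

Lemma punctured_derive_zero_eq (F : R -> R) (a b : R) :
  (forall x, continuous F x) ->
  (forall x, locally' x (fun y => a < y < b -> is_derive F y 0)) ->
  forall u v, a <= u -> u <= v -> v <= b -> F u = F v.
Proof.
intros HF H u v Hau Huv Hvb; apply Rle_antisym.
- apply punctured_derive_nonneg_le with a b; try assumption.
  intros x; generalize (H x); apply filter_imp; intros y Hy Hab; exists 0; split; auto; lra.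
- apply Ropp_le_cancel.
  apply (punctured_derive_nonneg_le (fun t => - F t) a b); try assumption.
  + intros x; apply (continuous_opp (V := R_NormedModule)), HF.
  + intros x; generalize (H x); apply filter_imp; intros y Hy Hab; exists 0; split; [lra|].
    replace 0 with (- 0) by ring.
    now apply (is_derive_opp (V := R_NormedModule)), Hy.
Qed.

Lemma continuous_Rmin_l (c x : R) : continuous (Rmin c) x.
Proof.
intros P [eps HP]; exists eps; intros y Hy; apply HP.
change (Rabs (y - x) < eps) in Hy; change (Rabs (Rmin c y - Rmin c x) < eps).
apply Rabs_def2 in Hy; unfold Rmin.
destruct (Rle_dec c y), (Rle_dec c x); apply Rabs_def1; lra.
Qed.

Lemma continuous_Rmax_l (c x : R) : continuous (Rmax c) x.
Proof.
intros P [eps HP]; exists eps; intros y Hy; apply HP.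
change (Rabs (y - x) < eps) in Hy; change (Rabs (Rmax c y - Rmax c x) < eps).
apply Rabs_def2 in Hy; unfold Rmax.
destruct (Rle_dec c y), (Rle_dec c x); apply Rabs_def1; lra.
Qed.

Lemma is_derive_eq_on (F G : R -> R) (p q y l c : R) :
  p < y < q -> (forall z, p < z < q -> G z = F z + c) -> is_derive F y l -> is_derive G y l.
Proof.
intros Hy H HF; apply is_derive_ext_loc with (fun z => plus (F z) c).
- apply locally_open_interval with p q; [assumption|]; intros z Hz; symmetry; now apply H.
- replace l with (l + 0) by ring.
  apply (is_derive_plus (V := R_NormedModule)); [assumption|].
  apply (is_derive_const (V := R_NormedModule)).
Qed.

(** Continuity is kept on the whole line, beyond the segment, so that antiderivatives on adjacent
    segments can be added without case distinctions. *)
Lemma antiderivative_segment (h : R -> R) :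
  (forall x, exists F, continuous F x /\ locally' x (fun y => is_derive F y (h y))) ->
  forall a b, a <= b -> exists F, (forall x, continuous F x) /\
    forall x, locally' x (fun y => a < y < b -> is_derive F y (h y)).
Proof.
intros Hloc; apply cousin.
- intros a c b Hac Hcb [F1 [C1 D1]] [F2 [C2 D2]].
  (* Each summand is constant on the side of [c] where the other one varies, so the derivative is
     [h] on both sides. *)
  pose (G := fun t => F1 (Rmin c t) + F2 (Rmax c t)).
  exists G; split.
  + intros x; apply (continuous_plus (V := R_NormedModule));
      apply (continuous_comp (V := R_UniformSpace)); auto using continuous_Rmin_l, continuous_Rmax_l.
  + intros x; generalize (filter_and _ _ (filter_and _ _ (D1 x) (D2 x)) (locally'_neq c x)).
    apply filter_imp; intros y [[H1 H2] Hyc] Hy.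
    destruct (Rlt_or_le y c).
    * apply is_derive_eq_on with F1 (y - 1) c (F2 c); [lra| |apply H1; lra].
      intros z Hz; unfold G; rewrite Rmin_right, Rmax_left by lra; reflexivity.
    * apply is_derive_eq_on with F2 c (y + 1) (F1 c); [lra| |apply H2; lra].
      intros z Hz; unfold G; rewrite Rmin_left, Rmax_right by lra; apply Rplus_comm.
- intros x; destruct (Hloc x) as [F [CF DF]].
  destruct (proj1 (locally'_ball x _) DF) as [d [Hd HQ]].
  exists d; split; [assumption|]; intros u v Hu Hux Hxv Hv.
  (* [F] is controlled only near [x]; clamping the argument to the segment from [u] to [v] makes it
     continuous everywhere. *)
  pose (G := fun t => F (Rmax u (Rmin v t))).
  exists G; split.
  + intros t; apply (continuous_comp (V := R_UniformSpace) (fun t => Rmax u (Rmin v t)) F).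
    * apply (continuous_comp (V := R_UniformSpace) (Rmin v) (Rmax u));
        auto using continuous_Rmin_l, continuous_Rmax_l.
    * assert (B : u <= Rmax u (Rmin v t) <= v).
      { split; [apply Rmax_l|]; apply Rmax_lub; [lra|apply Rmin_l]. }
      revert B; generalize (Rmax u (Rmin v t)); intros z Hz.
      destruct (Req_dec z x) as [->|Hzx]; [assumption|].
      apply (ex_derive_continuous (V := R_NormedModule)); exists (h z); apply HQ; lra.
  + intros z; generalize (locally'_neq x z); apply filter_imp; intros y Hyx Hy.
    apply is_derive_eq_on with F u v 0; [lra| |apply HQ; lra].
    intros w Hw; unfold G; rewrite Rmin_right, Rmax_right by lra; symmetry; apply Rplus_0_r.
Qed.

(** Antiderivatives on the intervals from [- n] to [n] differ by constants on overlaps, so after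
    subtracting their values at 0 they extend one another. *)
Lemma antiderivative_line (h : R -> R) :
  (forall x, exists F, continuous F x /\ locally' x (fun y => is_derive F y (h y))) ->
  exists F, (forall x, continuous F x) /\ forall x, locally' x (fun y => is_derive F y (h y)).
Proof.
intros Hloc.
assert (Hn : forall n : nat, exists F, (forall x, continuous F x) /\
  forall x, locally' x (fun y => - INR n < y < INR n -> is_derive F y (h y))).
{ intros n; apply antiderivative_segment; [assumption|].
  generalize (pos_INR n); lra. }
pose (Fn := fun n => proj1_sig (constructive_indefinite_description _ (Hn n))).
assert (HF : forall n, (forall x, continuous (Fn n) x) /\
  forall x, locally' x (fun y => - INR n < y < INR n -> is_derive (Fn n) y (h y))).
{ intros n; exact (proj2_sig (constructive_indefinite_description _ (Hn n))). }
clearbody Fn; clear Hn Hloc.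
assert (Heq : forall m n t, (m <= n)%nat -> Rabs t <= INR m ->
  Fn m t - Fn m 0 = Fn n t - Fn n 0).
{ intros m n t Hmn Ht; apply Rabs_le_between in Ht.
  apply le_INR in Hmn; generalize (pos_INR m); intros Hm.
  assert (K : forall u v, - INR m <= u -> u <= v -> v <= INR m ->
    Fn m u - Fn n u = Fn m v - Fn n v).
  { apply (punctured_derive_zero_eq (fun t => Fn m t - Fn n t)).
    - intros x; apply (continuous_minus (V := R_NormedModule)); apply HF.
    - intros x; generalize (filter_and _ _ (proj2 (HF m) x) (proj2 (HF n) x)).
      apply filter_imp; intros y [H1 H2] Hy.
      replace 0 with (h y - h y) by ring.
      apply (is_derive_minus (V := R_NormedModule)); [apply H1|apply H2]; lra. }
  destruct (Rle_or_lt t 0) as [H|H]; [generalize (K t 0)|generalize (K 0 t)]; lra. }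
pose (N := fun t : R => Z.to_nat (up (Rabs t))).
assert (HN : forall t, Rabs t <= INR (N t)).
{ intros t; unfold N; destruct (archimed (Rabs t)) as [H _].
  generalize (Rabs_pos t); intros.
  rewrite INR_IZR_INZ, Z2Nat.id; [lra|].
  apply le_IZR; lra. }
pose (F := fun t => Fn (N t) t - Fn (N t) 0).
assert (HFn : forall n t, Rabs t <= INR n -> F t = Fn n t + - Fn n 0).
{ intros n t Ht; unfold F.
  destruct (Nat.le_ge_cases (N t) n) as [H|H].
  - now rewrite (Heq _ _ t H (HN t)).
  - now rewrite <- (Heq _ _ t H Ht). }
(* The margin 1 lets one index [n] serve a whole neighbourhood of [x], as continuity and derivatives
   require, although [N] jumps. *)
assert (HFx : forall x n, Rabs x + 1 <= INR n ->
  forall z, x - 1 < z < x + 1 -> F z = Fn n z + - Fn n 0).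
{ intros x n Hn z Hz; apply HFn; revert Hn; unfold Rabs.
  destruct (Rcase_abs x), (Rcase_abs z); lra. }
assert (Hbig : forall x, exists n, Rabs x + 1 <= INR n).
{ intros x; exists (N (Rabs x + 1)).
  eapply Rle_trans; [|apply HN]; apply Rle_abs. }
exists F; split; intros x; destruct (Hbig x) as [n Hn].
- apply continuous_ext_loc with (fun z => plus (Fn n z) (- Fn n 0)).
  + apply locally_open_interval with (x - 1) (x + 1); [lra|].
    intros z Hz; symmetry; now apply (HFx x).
  + apply (continuous_plus (V := R_NormedModule)); [apply HF|apply continuous_const].
- generalize (filter_and _ _ (locally'_near x 1 Rlt_0_1) (proj2 (HF n) x)).
  apply filter_imp; intros y [Hy H].
  apply is_derive_eq_on with (Fn n) (x - 1) (x + 1) (- Fn n 0);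
    [lra|now apply (HFx x)|apply H].
  revert Hn; unfold Rabs; destruct (Rcase_abs x); lra.
Qed.

(** * Calculus of complex-valued functions *)

Lemma C_eq (a b : C) : Re a = Re b -> Im a = Im b -> a = b.
Proof. destruct a, b; simpl; intros -> ->; reflexivity. Qed.

Lemma continuous_C (f : R -> C) (x : R) :
  continuous f x <-> continuous (fun t => Re (f t)) x /\ continuous (fun t => Im (f t)) x.
Proof.
split.
- intros H; split; apply (continuous_comp (V := C_UniformSpace) f); try assumption.
  + destruct (f x) as [u v]; apply (continuous_fst (U := R_UniformSpace) (V := R_UniformSpace)).
  + destruct (f x) as [u v]; apply (continuous_snd (U := R_UniformSpace) (V := R_UniformSpace)).
- intros [H1 H2].
  apply (continuous_ext (U := C_UniformSpace)
           (fun t => (fun u v : R => ((u, v) : C)) (Re (f t)) (Im (f t)))).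
  + intros t; now destruct (f t).
  + apply (continuous_comp_2 (X := C_UniformSpace)); try assumption.
    apply (continuous_ext (T := prod_UniformSpace R_UniformSpace R_UniformSpace)
             (U := C_UniformSpace) (fun z => z)).
    * now intros [u v].
    * apply continuous_id.
Qed.

Lemma continuous_Re (f : R -> C) (x : R) : continuous f x -> continuous (fun t => Re (f t)) x.
Proof. intros H; now apply continuous_C. Qed.

Lemma continuous_Im (f : R -> C) (x : R) : continuous f x -> continuous (fun t => Im (f t)) x.
Proof. intros H; now apply continuous_C. Qed.

Lemma continuous_Cconst (c : C) (x : R) : continuous (fun _ : R => c) x.
Proof. apply (continuous_const (V := C_UniformSpace)). Qed.

Lemma continuous_RtoC (f : R -> R) (x : R) : continuous f x -> continuous (fun t => RtoC (f t)) x.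
Proof. intros H; apply continuous_C; split; [exact H|apply continuous_const]. Qed.

Lemma continuous_Cplus (f g : R -> C) (x : R) :
  continuous f x -> continuous g x -> continuous (fun t => f t + g t)%C x.
Proof.
intros Hf Hg; apply continuous_C in Hf, Hg; apply continuous_C; split;
  apply (continuous_plus (V := R_NormedModule)); tauto.
Qed.

Lemma continuous_Copp (f : R -> C) (x : R) :
  continuous f x -> continuous (fun t => - f t)%C x.
Proof.
intros Hf; apply continuous_C in Hf; apply continuous_C; split;
  apply (continuous_opp (V := R_NormedModule)); tauto.
Qed.

Lemma continuous_Cmult (f g : R -> C) (x : R) :
  continuous f x -> continuous g x -> continuous (fun t => f t * g t)%C x.
Proof.
intros Hf Hg; apply continuous_C in Hf, Hg; apply continuous_C; split.
- apply (continuous_minus (V := R_NormedModule)); apply (continuous_mult (K := R_AbsRing)); tauto.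
- apply (continuous_plus (V := R_NormedModule)); apply (continuous_mult (K := R_AbsRing)); tauto.
Qed.

Lemma continuous_Cconj (f : R -> C) (x : R) :
  continuous f x -> continuous (fun t => Cconj (f t)) x.
Proof.
intros Hf; apply continuous_C in Hf; apply continuous_C; split; [tauto|].
apply (continuous_opp (V := R_NormedModule)); tauto.
Qed.

Lemma continuous_Cmod (f : R -> C) (x : R) :
  continuous f x -> continuous (fun t => Cmod (f t)) x.
Proof.
intros H; apply (continuous_comp (V := C_UniformSpace) f Cmod); [assumption|].
apply (filterlim_norm (V := C_NormedModule)).
Qed.

Lemma continuous_shift (f : R -> C) (c x : R) :
  continuous f (x + c) -> continuous (fun t => f (t + c)) x.
Proof.
intros H; apply (continuous_comp (V := R_UniformSpace) (fun t => t + c) f); [|assumption].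
apply (continuous_plus (V := R_NormedModule)); [apply continuous_id|apply continuous_const].
Qed.

(** Componentwise form of the derivative, in which the product, exponential and inverse rules reduce
    to real computations by [auto_derive]. *)
Definition cderive (f : R -> C) (x : R) (l : C) : Prop :=
  is_derive (fun t => Re (f t)) x (Re l) /\ is_derive (fun t => Im (f t)) x (Im l).

Lemma is_derive_C (f : R -> C) (x : R) (l : C) :
  is_derive (V := C_R_NormedModule) f x l <-> cderive f x l.
Proof.
split.
- intros H; split.
  + apply (filterdiff_comp (V := C_R_NormedModule) f (fun z => Re z)
             (fun y => scal y l) (fun z => Re z)); [exact H|].
    apply (filterdiff_linear (U := C_R_NormedModule)), is_linear_fst.
  + apply (filterdiff_comp (V := C_R_NormedModule) f (fun z => Im z)
             (fun y => scal y l) (fun z => Im z)); [exact H|].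
    apply (filterdiff_linear (U := C_R_NormedModule)), is_linear_snd.
- intros [H1 H2].
  apply (is_derive_ext (V := C_R_NormedModule)
    (fun t => plus (scal (Re (f t)) (RtoC 1 : C_R_NormedModule)) (scal (Im (f t)) (Ci : C_R_NormedModule)))).
  + intros t; apply C_eq;
      [change (Re (f t) * 1 + Im (f t) * 0 = Re (f t))
      |change (Re (f t) * 0 + Im (f t) * 1 = Im (f t))]; ring.
  + replace l with (plus (scal (Re l) (RtoC 1 : C_R_NormedModule)) (scal (Im l) (Ci : C_R_NormedModule))).
    * apply (is_derive_plus (V := C_R_NormedModule)); now apply (is_derive_scal_l (V := C_R_NormedModule)).
    * apply C_eq;
        [change (Re l * 1 + Im l * 0 = Re l)|change (Re l * 0 + Im l * 1 = Im l)]; ring.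
Qed.

Lemma cderive_ext_loc (f h : R -> C) (x : R) (l : C) :
  locally x (fun t => f t = h t) -> cderive f x l -> cderive h x l.
Proof.
intros H [H1 H2]; split.
- refine (is_derive_ext_loc _ _ _ _ _ H1); revert H; apply filter_imp; now intros t ->.
- refine (is_derive_ext_loc _ _ _ _ _ H2); revert H; apply filter_imp; now intros t ->.
Qed.

Lemma cderive_continuous (f : R -> C) (x : R) (l : C) : cderive f x l -> continuous f x.
Proof.
intros [H1 H2]; apply continuous_C; split; apply (ex_derive_continuous (V := R_NormedModule));
  eexists; eassumption.
Qed.

Ltac solve_derive :=
  auto_derive; [repeat split; try (eexists; eassumption); try assumption|
    repeat match goal with H : is_derive _ ?x ?l |- context [Derive ?u ?x] =>
      change (is_derive u x l) in H; rewrite (is_derive_unique _ _ _ H); clear H end].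

Lemma cderive_plus (f h : R -> C) (x : R) (l m : C) :
  cderive f x l -> cderive h x m -> cderive (fun t => f t + h t)%C x (l + m)%C.
Proof.
intros [H1 H2] [H3 H4]; split; apply (is_derive_plus (V := R_NormedModule)); assumption.
Qed.

Lemma cderive_mult (f h : R -> C) (x : R) (l m : C) :
  cderive f x l -> cderive h x m ->
  cderive (fun t => f t * h t)%C x (l * h x + f x * m)%C.
Proof.
intros [H1 H2] [H3 H4]; split.
- apply is_derive_ext with (fun t => Re (f t) * Re (h t) - Im (f t) * Im (h t)); [easy|].
  set (a := fun t => Re (f t)) in *; set (b := fun t => Im (f t)) in *.
  set (c := fun t => Re (h t)) in *; set (d := fun t => Im (h t)) in *.
  apply is_derive_ext with (fun t => a t * c t - b t * d t); [easy|].
  replace (Re (l * h x + f x * m)) with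
    (Re l * c x + a x * Re m - (Im l * d x + b x * Im m)).
  + solve_derive; ring.
  + unfold a, b, c, d; rewrite re_plus, !re_mult; ring.
- set (a := fun t => Re (f t)) in *; set (b := fun t => Im (f t)) in *.
  set (c := fun t => Re (h t)) in *; set (d := fun t => Im (h t)) in *.
  apply is_derive_ext with (fun t => a t * d t + b t * c t); [easy|].
  replace (Im (l * h x + f x * m)) with
    (Re l * d x + a x * Im m + (Im l * c x + b x * Re m)).
  + solve_derive; ring.
  + unfold a, b, c, d; rewrite im_plus, !im_mult; ring.
Qed.

Lemma cderive_conj (f : R -> C) (x : R) (l : C) :
  cderive f x l -> cderive (fun t => Cconj (f t)) x (Cconj l).
Proof. intros [H1 H2]; split; [exact H1|now apply (is_derive_opp (V := R_NormedModule))]. Qed.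

Lemma cderive_shift (f : R -> C) (c x : R) (l : C) :
  cderive f (x + c) l -> cderive (fun t => f (t + c)) x l.
Proof.
assert (K : forall (u : R -> R) (m : R), is_derive u (x + c) m -> is_derive (fun t => u (t + c)) x m).
{ intros u m Hu; replace m with (1 * m) by ring.
  apply (is_derive_comp (V := R_NormedModule) u (fun t => t + c)); [assumption|].
  auto_derive; [easy|ring]. }
intros [H1 H2]; split; now apply (K (fun t => _ (f t))).
Qed.

Lemma cderive_cexp (f : R -> C) (x : R) (l : C) :
  cderive f x l -> cderive (fun t => cexp (f t)) x (l * cexp (f x))%C.
Proof.
intros [H1 H2].
set (a := fun t => Re (f t)) in *; set (b := fun t => Im (f t)) in *.
split.
- apply is_derive_ext with (fun t => exp (a t) * cos (b t)); [easy|].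
  replace (Re (l * cexp (f x))) with
    (Re l * exp (a x) * cos (b x) - exp (a x) * (Im l * sin (b x))).
  + solve_derive; ring.
  + unfold a, b, cexp; rewrite re_mult; simpl; ring.
- apply is_derive_ext with (fun t => exp (a t) * sin (b t)); [easy|].
  replace (Im (l * cexp (f x))) with
    (Re l * exp (a x) * sin (b x) + exp (a x) * (Im l * cos (b x))).
  + solve_derive; ring.
  + unfold a, b, cexp; rewrite im_mult; simpl; ring.
Qed.

Lemma cderive_inv (f : R -> C) (x : R) (l : C) :
  f x <> RtoC 0 -> cderive f x l -> cderive (fun t => / f t)%C x (- l / (f x * f x))%C.
Proof.
intros Hf [H1 H2].
assert (Hn : Re (f x) ^ 2 + Im (f x) ^ 2 <> 0).
{ intros H0; apply Hf; apply C_eq; simpl; nra. }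
set (a := fun t => Re (f t)) in *; set (b := fun t => Im (f t)) in *.
(* This is the squared modulus of [f x * f x], the denominator met by [field] in the claimed
   derivative. *)
assert (Hn' : (Re (f x) * Re (f x) - Im (f x) * Im (f x)) ^ 2
          + (Re (f x) * Im (f x) + Im (f x) * Re (f x)) ^ 2 <> 0).
{ replace ((Re (f x) * Re (f x) - Im (f x) * Im (f x)) ^ 2
          + (Re (f x) * Im (f x) + Im (f x) * Re (f x)) ^ 2)
    with ((Re (f x) ^ 2 + Im (f x) ^ 2) * (Re (f x) ^ 2 + Im (f x) ^ 2)) by ring.
  now apply Rmult_integral_contrapositive. }
split.
- apply is_derive_ext with (fun t => a t / (a t ^ 2 + b t ^ 2)); [easy|].
  change (a x ^ 2 + b x ^ 2 <> 0) in Hn.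
  solve_derive.
  unfold Cdiv; rewrite re_mult.
  change (Re (f x)) with (a x) in Hn'; change (Im (f x)) with (b x) in Hn'.
  unfold Cinv, Copp, Cmult; simpl.
  change (fst (f x)) with (a x); change (snd (f x)) with (b x).
  change (fst l) with (Re l); change (snd l) with (Im l).
  simpl in Hn, Hn'; rewrite ?Rmult_1_r in Hn, Hn'; field; split; assumption.
- apply is_derive_ext with (fun t => - b t / (a t ^ 2 + b t ^ 2)); [easy|].
  change (a x ^ 2 + b x ^ 2 <> 0) in Hn.
  solve_derive.
  unfold Cdiv; rewrite im_mult.
  change (Re (f x)) with (a x) in Hn'; change (Im (f x)) with (b x) in Hn'.
  unfold Cinv, Copp, Cmult; simpl.
  change (fst (f x)) with (a x); change (snd (f x)) with (b x).
  change (fst l) with (Re l); change (snd l) with (Im l).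
  simpl in Hn, Hn'; rewrite ?Rmult_1_r in Hn, Hn'; field; split; assumption.
Qed.

(* Equivalent to [Cp0]: near each point, [|f|] is at most the derivative of a function that is
   continuous across the point.  No improper integral occurs, and sums and products with
   continuous functions are immediate. *)
Definition dominated (f : R -> C) : Prop :=
  forall x, exists Phi phi : R -> R, continuous Phi x /\
    locally' x (fun y =>
      continuous f y /\ is_derive Phi y (phi y) /\ Cmod (f y) <= phi y).

(* [F' = f] is required only off a locally finite set, as in [Cp1]. *)
Definition cprimitive (F f : R -> C) : Prop :=
  (forall x, continuous F x) /\ forall x, locally' x (fun y => cderive F y (f y)).

Lemma continuous_locally_le (h : R -> R) (x : R) :
  continuous h x -> locally x (fun y => h y <= h x + 1).
Proof.
intros H; apply (H (fun z => z <= h x + 1)).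
exists (mkposreal 1 Rlt_0_1); intros z Hz.
apply Rabs_def2 in Hz; unfold minus, plus, opp in Hz; simpl in Hz; lra.
Qed.

Lemma locally_locally' (x : R) (P : R -> Prop) : locally x P -> locally' x P.
Proof. unfold locally', within; apply filter_imp; auto. Qed.

Lemma dominated_at_continuity_point (f : R -> C) (x : R) :
  continuous f x -> locally' x (continuous f) ->
  exists Phi phi : R -> R, continuous Phi x /\
    locally' x (fun y =>
      continuous f y /\ is_derive Phi y (phi y) /\ Cmod (f y) <= phi y).
Proof.
intros Hx H.
exists (fun t => (Cmod (f x) + 1) * t), (fun _ => Cmod (f x) + 1); split.
- apply (ex_derive_continuous (V := R_NormedModule)); auto_derive; easy.
- generalize (filter_and _ _ H
    (locally_locally' _ _ (continuous_locally_le _ _ (continuous_Cmod _ _ Hx)))).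
  apply filter_imp; intros y [H1 H2]; split; [assumption|split; [|assumption]].
  auto_derive; [easy|ring].
Qed.

Lemma continuous_dominated (f : R -> C) : (forall x, continuous f x) -> dominated f.
Proof.
intros H x; apply dominated_at_continuity_point; [apply H|now apply filter_forall].
Qed.

Lemma dominated_plus (f h : R -> C) :
  dominated f -> dominated h -> dominated (fun x => f x + h x)%C.
Proof.
intros Hf Hh x.
destruct (Hf x) as [Phi [phi [C1 H1]]], (Hh x) as [Psi [psi [C2 H2]]].
exists (fun t => Phi t + Psi t), (fun t => phi t + psi t); split.
- now apply (continuous_plus (V := R_NormedModule)).
- generalize (filter_and _ _ H1 H2); apply filter_imp.
  intros y [[K1 [K2 K3]] [L1 [L2 L3]]]; split; [|split].
  + now apply continuous_Cplus.
  + now apply (is_derive_plus (V := R_NormedModule)).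
  + eapply Rle_trans; [apply Cmod_triangle|lra].
Qed.

Lemma dominated_mult (c f : R -> C) :
  (forall x, continuous c x) -> dominated f -> dominated (fun x => c x * f x)%C.
Proof.
intros Hc Hf x.
destruct (Hf x) as [Phi [phi [C1 H1]]].
exists (fun t => (Cmod (c x) + 1) * Phi t), (fun t => (Cmod (c x) + 1) * phi t); split.
- now apply (continuous_scal_r (V := R_NormedModule)).
- generalize (filter_and _ _ H1
    (locally_locally' _ _ (continuous_locally_le _ _ (continuous_Cmod _ _ (Hc x))))).
  apply filter_imp; intros y [[K1 [K2 K3]] K4]; split; [|split].
  + now apply continuous_Cmult.
  + now apply (is_derive_scal Phi).
  + rewrite Cmod_mult; apply Rmult_le_compat; auto using Cmod_ge_0.
Qed.

Lemma dominated_ext (f h : R -> C) : (forall x, f x = h x) -> dominated f -> dominated h.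
Proof.
intros E H x; destruct (H x) as [Phi [phi [C1 H1]]]; exists Phi, phi; split; [assumption|].
revert H1; apply filter_imp; intros y [K1 [K2 K3]]; split; [|split]; try assumption.
- now apply (continuous_ext f).
- now rewrite <- E.
Qed.

Lemma dominated_has_cprimitive (f : R -> C) : dominated f -> exists F, cprimitive F f.
Proof.
intros H.
destruct (antiderivative_line (fun t => Re (f t))) as [A [CA DA]].
{ intros x; destruct (H x) as [Phi [phi [C1 H1]]].
  apply dominated_antiderivative_at with phi Phi; [assumption|].
  revert H1; apply filter_imp; intros y [K1 [K2 K3]]; split; [|split]; try assumption.
  - now apply continuous_Re.
  - eapply Rle_trans; [apply re_le_Cmod|assumption]. }
destruct (antiderivative_line (fun t => Im (f t))) as [B [CB DB]].
{ intros x; destruct (H x) as [Phi [phi [C1 H1]]].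
  apply dominated_antiderivative_at with phi Phi; [assumption|].
  revert H1; apply filter_imp; intros y [K1 [K2 K3]]; split; [|split]; try assumption.
  - now apply continuous_Im.
  - eapply Rle_trans; [|exact K3].
    eapply Rle_trans; [apply Rmax_r|apply Rmax_Cmod]. }
exists (fun t => (A t, B t)); split.
- intros x; apply continuous_C; split; [apply CA|apply CB].
- intros x; generalize (filter_and _ _ (DA x) (DB x)); apply filter_imp.
  intros y [H1 H2]; split; assumption.
Qed.

(** * Improper integrals and local domination *)

(** With one end fixed by [at_point], convergence along the product filter becomes an ordinary limit
    in the other end. *)
Lemma ex_RInt_gen_left_end (h : R -> R) (G : (R -> Prop) -> Prop) (c : R) :
  ProperFilter G -> ex_RInt_gen h G (at_point c) ->
  G (fun t => ex_RInt h t c) /\ exists l, filterlim (fun t => RInt h t c) G (locally l).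
Proof.
intros HG [l Hl].
assert (K : forall P : R -> Prop, locally l P -> G (fun t => exists y, is_RInt h t c y /\ P y)).
{ intros P HP; destruct (Hl P HP) as [Q S HQ HS HQS].
  revert HQ; apply filter_imp; intros t Ht; apply (HQS t c Ht HS). }
split.
- generalize (K (fun _ => True) (filter_true)); apply filter_imp.
  intros t [y [Hy _]]; now exists y.
- exists l; intros P HP; generalize (K P HP); unfold filtermap; apply filter_imp.
  intros t [y [Hy HPy]]; now rewrite (is_RInt_unique _ _ _ _ Hy).
Qed.

Lemma ex_RInt_gen_right_end (h : R -> R) (G : (R -> Prop) -> Prop) (c : R) :
  ProperFilter G -> ex_RInt_gen h (at_point c) G ->
  G (fun t => ex_RInt h c t) /\ exists l, filterlim (fun t => RInt h c t) G (locally l).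
Proof.
intros HG [l Hl].
assert (K : forall P : R -> Prop, locally l P -> G (fun t => exists y, is_RInt h c t y /\ P y)).
{ intros P HP; destruct (Hl P HP) as [Q S HQ HS HQS].
  revert HS; apply filter_imp; intros t Ht; apply (HQS c t HQ Ht). }
split.
- generalize (K (fun _ => True) (filter_true)); apply filter_imp.
  intros t [y [Hy _]]; now exists y.
- exists l; intros P HP; generalize (K P HP); unfold filtermap; apply filter_imp.
  intros t [y [Hy HPy]]; now rewrite (is_RInt_unique _ _ _ _ Hy).
Qed.

Lemma at_right_locally (x : R) (P : R -> Prop) :
  at_right x P -> at_right x (fun y => locally y P).
Proof.
intros [d Hd]; exists d; intros y Hy Hxy.
apply Rabs_def2 in Hy; unfold minus, plus, opp in Hy; simpl in Hy.
apply locally_open_interval with x (x + d); [lra|].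
intros z Hz; apply Hd; [apply Rabs_def1; unfold minus, plus, opp; simpl|]; lra.
Qed.

Lemma at_left_locally (x : R) (P : R -> Prop) :
  at_left x P -> at_left x (fun y => locally y P).
Proof.
intros [d Hd]; exists d; intros y Hy Hxy.
apply Rabs_def2 in Hy; unfold minus, plus, opp in Hy; simpl in Hy.
apply locally_open_interval with (x - d) x; [lra|].
intros z Hz; apply Hd; [apply Rabs_def1; unfold minus, plus, opp; simpl|]; lra.
Qed.

(** At a listed point the convergent one-sided integrals of [|f|], as functions of their moving end,
    are antiderivatives of [|f|] with limits at that point; glued together they form [Phi], with
    [phi] equal to [|f|]. Elsewhere [f] is continuous and a linear [Phi] suffices. *)
Lemma Cp0_dominated (f : R -> C) : Cp0 f -> dominated f.
Proof.
intros H x; destruct (H (x - 1) (x + 1)) as [D [HD1 HD2]]; [lra|].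
assert (HC : locally' x (continuous f)).
{ generalize (filter_and _ _ (locally'_near x 1 Rlt_0_1) (locally'_notin D x)).
  apply filter_imp; intros y [Hy HyD]; apply HD1; [lra|assumption]. }
destruct (in_dec Req_dec_T x D) as [Hi|Hi].
2: { apply dominated_at_continuity_point; [apply HD1; [lra|]|]; assumption. }
destruct (HD2 x Hi) as [eps [Heps [Hr Hl]]].
apply ex_RInt_gen_left_end in Hr; [|apply _].
apply ex_RInt_gen_right_end in Hl; [|apply _].
destruct Hr as [Er [lr Hr]], Hl as [El [ll Hl]].
assert (HC' : locally' x (continuous (fun t => Cmod (f t)))).
{ revert HC; apply filter_imp; intros y; apply continuous_Cmod. }
apply locally'_sides in HC'; destruct HC' as [Cl Cr].
(* On the right the moving end is the lower bound of the integral, hence the sign. *)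
destruct (glue_at (fun t => opp (RInt (fun s => Cmod (f s)) t (x + eps)))
  (fun t => RInt (fun s => Cmod (f s)) (x - eps) t) x (opp lr) ll
  (fun t => Cmod (f t))) as [Phi [CPhi DPhi]].
- eapply filterlim_comp; [exact Hr|apply (filterlim_opp (V := R_NormedModule))].
- exact Hl.
- generalize (filter_and (F := at_right x) _ _ Cr (at_right_locally _ _ Er)); apply filter_imp.
  intros y [Hy1 Hy2].
  replace (Cmod (f y)) with (opp (opp (Cmod (f y)))) by apply opp_opp.
  apply (is_derive_opp (V := R_NormedModule)).
  apply (is_derive_RInt' (V := R_NormedModule) (fun s => Cmod (f s)) _ y (x + eps)); [|assumption].
  revert Hy2; apply filter_imp; intros z Hz.
  now apply (RInt_correct (V := R_CompleteNormedModule)).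
- generalize (filter_and (F := at_left x) _ _ Cl (at_left_locally _ _ El)); apply filter_imp.
  intros y [Hy1 Hy2].
  apply (is_derive_RInt (V := R_NormedModule) (fun s => Cmod (f s)) _ (x - eps) y); [|assumption].
  revert Hy2; apply filter_imp; intros z Hz.
  now apply (RInt_correct (V := R_CompleteNormedModule)).
- exists Phi, (fun t => Cmod (f t)); split; [assumption|].
  generalize (filter_and _ _ HC DPhi); apply filter_imp.
  intros y [Hy1 Hy2]; split; [|split]; try assumption; lra.
Qed.

(** Domination gives [|f|] an antiderivative [F] continuous at [x]. Integrals with an end
    approaching [x] are differences of values of [F], so they converge. *)
Lemma dominated_Cp0 (f : R -> C) : dominated f -> Cp0 f.
Proof.
intros H a b Hab.
destruct (proj2 (locally_finite_exceptions (continuous f))) with a b as [D HD]; [|assumption|].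
{ intros x; destruct (H x) as [Phi [phi [_ K]]]; revert K; apply filter_imp; tauto. }
exists D; split; [assumption|]; intros x _.
destruct (H x) as [Phi [phi [CPhi K]]].
assert (K' : locally' x (fun y => continuous (fun t => Cmod (f t)) y /\
  is_derive Phi y (phi y) /\ Rabs (Cmod (f y)) <= phi y)).
{ revert K; apply filter_imp; intros y [K1 [K2 K3]]; split; [|split]; try assumption.
  - now apply continuous_Cmod.
  - rewrite Rabs_pos_eq; [assumption|apply Cmod_ge_0]. }
destruct (dominated_antiderivative_at _ phi Phi x CPhi K') as [F [CF DF]].
generalize (filter_and _ _ K' DF); intros Q.
apply locally'_ball in Q; destruct Q as [d [Hd Q]].
assert (I : forall s t, x - d < s -> t < x + d -> s <= t -> (t < x \/ x < s) ->
  is_RInt (fun t => Cmod (f t)) s t (F t - F s)).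
{ intros s t Hs Ht Hst Hx.
  apply (is_RInt_derive (V := R_CompleteNormedModule) F);
    rewrite Rmin_left, Rmax_right by lra; intros y Hy; apply Q; lra. }
assert (CR : filterlim F (at_right x) (locally (F x))).
{ eapply filterlim_filter_le_1; [|exact CF].
  intros P HP; unfold at_right, within; revert HP; apply filter_imp; auto. }
assert (CL : filterlim F (at_left x) (locally (F x))).
{ eapply filterlim_filter_le_1; [|exact CF].
  intros P HP; unfold at_left, within; revert HP; apply filter_imp; auto. }
assert (Nr : at_right x (fun y => x < y < x + d / 2)).
{ generalize (proj2 (proj1 (locally'_sides _ _) (locally'_near x (d / 2) ltac:(lra)))).
  unfold at_right, within; apply filter_imp; intros y Hy Hxy; generalize (Hy Hxy); lra. }
assert (Nl : at_left x (fun y => x - d / 2 < y < x)).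
{ generalize (proj1 (proj1 (locally'_sides _ _) (locally'_near x (d / 2) ltac:(lra)))).
  unfold at_left, within; apply filter_imp; intros y Hy Hxy; generalize (Hy Hxy); lra. }
exists (d / 2); split; [lra|split].
- exists (F (x + d / 2) - F x); intros P HP.
  assert (L : filterlim (fun t => F (x + d / 2) - F t) (at_right x)
                (locally (F (x + d / 2) - F x))).
  { apply (filterlim_comp_2 (G := locally (F (x + d / 2))) (H := locally (- F x)) (fun _ => F (x + d / 2)) (fun t => - F t) Rplus).
    - apply filterlim_const.
    - eapply filterlim_comp; [exact CR|apply (filterlim_opp (V := R_NormedModule))].
    - apply (filterlim_plus (V := R_NormedModule)). }
  exists (fun t => x < t < x + d / 2 /\ P (F (x + d / 2) - F t)) (fun t => t = x + d / 2).
  + apply (filter_and (F := at_right x)); [exact Nr|exact (L P HP)].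
  + reflexivity.
  + intros s t [Hs HPs] ->; exists (F (x + d / 2) - F s); split; [|assumption].
    apply I; simpl; lra.
- exists (F x - F (x - d / 2)); intros P HP.
  assert (L : filterlim (fun t => F t - F (x - d / 2)) (at_left x)
                (locally (F x - F (x - d / 2)))).
  { apply (filterlim_comp_2 (G := locally (F x)) (H := locally (- F (x - d / 2))) F (fun _ => - F (x - d / 2)) Rplus).
    - exact CL.
    - apply filterlim_const.
    - apply (filterlim_plus (V := R_NormedModule)). }
  exists (fun t => t = x - d / 2) (fun t => x - d / 2 < t < x /\ P (F t - F (x - d / 2))).
  + reflexivity.
  + apply (filter_and (F := at_left x)); [exact Nl|exact (L P HP)].
  + intros s t -> [Ht HPt]; exists (F t - F (x - d / 2)); split; [|assumption].
    apply I; simpl; lra.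
Qed.

(** Dictionary between the function classes of the statement and the notions in which all later
    arguments are carried out. *)
Lemma Cp1_iff (F f : R -> C) : Cp1 F f <-> cprimitive F f /\ dominated f.
Proof.
split.
- intros [H1 [H2 H3]]; split; [split; [assumption|]|now apply Cp0_dominated].
  assert (K := proj1 (locally_finite_exceptions
    (fun x => is_derive (V := C_R_NormedModule) F x (f x))) H2).
  intros x; generalize (K x); apply filter_imp; intros y; apply is_derive_C.
- intros [[H1 H2] H3]; split; [assumption|split; [|now apply dominated_Cp0]].
  apply (locally_finite_exceptions
    (fun x => is_derive (V := C_R_NormedModule) F x (f x))).
  intros x; generalize (H2 x); apply filter_imp; intros y; apply is_derive_C.
Qed.

(** * Calculus rules for primitives *)

Lemma cprimitive_ext (F F' f f' : R -> C) :
  (forall x, F x = F' x) -> (forall x, f x = f' x) -> cprimitive F f -> cprimitive F' f'.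
Proof.
intros E e [H1 H2]; split.
- intros x; apply (continuous_ext F); [assumption|apply H1].
- intros x; generalize (H2 x); apply filter_imp; intros y Hy; rewrite <- e.
  revert Hy; apply cderive_ext_loc; now apply filter_forall.
Qed.

Lemma cprimitive_const (c : C) : cprimitive (fun _ => c) (fun _ => RtoC 0).
Proof.
split; [intros x; apply continuous_Cconst|].
intros x; apply filter_forall; intros y; split; apply (is_derive_const (V := R_NormedModule)).
Qed.

Lemma cprimitive_plus (F G f h : R -> C) : cprimitive F f -> cprimitive G h ->
  cprimitive (fun x => F x + G x)%C (fun x => f x + h x)%C.
Proof.
intros [H1 H2] [H3 H4]; split.
- intros x; now apply continuous_Cplus.
- intros x; generalize (filter_and _ _ (H2 x) (H4 x)); apply filter_imp.
  intros y [Hy1 Hy2]; now apply cderive_plus.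
Qed.

Lemma cprimitive_mult (F G f h : R -> C) : cprimitive F f -> cprimitive G h ->
  cprimitive (fun x => F x * G x)%C (fun x => f x * G x + F x * h x)%C.
Proof.
intros [H1 H2] [H3 H4]; split.
- intros x; now apply continuous_Cmult.
- intros x; generalize (filter_and _ _ (H2 x) (H4 x)); apply filter_imp.
  intros y [Hy1 Hy2]; now apply cderive_mult.
Qed.

Lemma cprimitive_conj (F f : R -> C) : cprimitive F f ->
  cprimitive (fun x => Cconj (F x)) (fun x => Cconj (f x)).
Proof.
intros [H1 H2]; split.
- intros x; now apply continuous_Cconj.
- intros x; generalize (H2 x); apply filter_imp; intros y; apply cderive_conj.
Qed.

Lemma continuous_cexp (F : R -> C) (x : R) :
  continuous F x -> continuous (fun t => cexp (F t)) x.
Proof.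
intros H; apply continuous_C in H; destruct H as [Hr Hi]; apply continuous_C; split;
  apply (continuous_mult (K := R_AbsRing)).
- apply (continuous_comp (V := R_UniformSpace)); [exact Hr|apply continuous_exp].
- apply (continuous_comp (V := R_UniformSpace)); [exact Hi|apply continuous_cos].
- apply (continuous_comp (V := R_UniformSpace)); [exact Hr|apply continuous_exp].
- apply (continuous_comp (V := R_UniformSpace)); [exact Hi|apply continuous_sin].
Qed.

Lemma cprimitive_cexp (F f : R -> C) : cprimitive F f ->
  cprimitive (fun x => cexp (F x)) (fun x => f x * cexp (F x))%C.
Proof.
intros [H1 H2]; split.
- intros x; apply continuous_cexp, H1.
- intros x; generalize (H2 x); apply filter_imp; intros y; apply cderive_cexp.
Qed.

Lemma continuous_Cinv (f : R -> C) (x : R) :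
  f x <> RtoC 0 -> continuous f x -> continuous (fun t => / f t)%C x.
Proof.
intros Hf H; apply continuous_C in H; destruct H as [Hr Hi].
assert (Hn : Re (f x) ^ 2 + Im (f x) ^ 2 <> 0).
{ intros H0; apply Hf; apply C_eq; simpl; nra. }
assert (Hd : continuous (fun t => / (Re (f t) ^ 2 + Im (f t) ^ 2)) x).
{ apply continuous_Rinv_comp; [|assumption].
  apply (continuous_plus (V := R_NormedModule)); simpl;
    apply (continuous_mult (K := R_AbsRing)); try assumption;
    apply (continuous_mult (K := R_AbsRing)); try assumption; apply continuous_const. }
apply continuous_C; split; apply (continuous_mult (K := R_AbsRing)); try assumption.
now apply (continuous_opp (V := R_NormedModule)).
Qed.

Lemma cprimitive_inv (F f : R -> C) : (forall x, F x <> RtoC 0) -> cprimitive F f ->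
  cprimitive (fun x => / F x)%C (fun x => - f x / (F x * F x))%C.
Proof.
intros H0 [H1 H2]; split.
- intros x; now apply continuous_Cinv.
- intros x; generalize (H2 x); apply filter_imp; intros y; now apply cderive_inv.
Qed.

Lemma locally'_shift (c x : R) (P : R -> Prop) :
  locally' (x + c) P -> locally' x (fun y => P (y + c)).
Proof.
intros H; apply locally'_ball in H; destruct H as [d [Hd H]].
apply locally'_ball; exists d; split; [assumption|]; intros y Hy Hyx; apply H; lra.
Qed.

Lemma cprimitive_shift (F f : R -> C) (c : R) : cprimitive F f ->
  cprimitive (fun x => F (x + c)) (fun x => f (x + c)).
Proof.
intros [H1 H2]; split.
- intros x; now apply continuous_shift.
- intros x; generalize (locally'_shift _ _ _ (H2 (x + c))); apply filter_imp.
  intros y; apply cderive_shift.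
Qed.

Lemma cprimitive_id : cprimitive (fun x => RtoC x) (fun _ => RtoC 1).
Proof.
split.
- intros x; apply continuous_RtoC, continuous_id.
- intros x; apply filter_forall; intros y; split; simpl.
  + apply (is_derive_id (K := R_AbsRing)).
  + apply (is_derive_const (V := R_NormedModule)).
Qed.

Lemma cprimitive_zero_const (F f : R -> C) : (forall x, f x = RtoC 0) -> cprimitive F f ->
  forall x y, F x = F y.
Proof.
intros Hf [H1 H2].
assert (K : forall u v, u <= v -> F u = F v).
{ intros u v Huv; apply C_eq.
  - apply (punctured_derive_zero_eq (fun t => Re (F t)) u v); try lra.
    + intros x; now apply continuous_Re.
    + intros x; generalize (H2 x); apply filter_imp; intros y [Hy _] _.
      now rewrite Hf in Hy.
  - apply (punctured_derive_zero_eq (fun t => Im (F t)) u v); try lra.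
    + intros x; now apply continuous_Im.
    + intros x; generalize (H2 x); apply filter_imp; intros y [_ Hy] _.
      now rewrite Hf in Hy. }
intros x y; destruct (Rle_or_lt x y); [|symmetry]; apply K; lra.
Qed.

(** * Solutions of the differential equation *)

(** The equation as a first-order system in [y] and [y1]: the second derivative is eliminated, and
    only continuous functions remain as unknowns. *)
Definition solution (V W : R -> C) (lam : R) (y y1 : R -> C) : Prop :=
  cprimitive y y1 /\ cprimitive y1 (fun x => W x * y1 x + (V x - RtoC lam) * y x)%C.

Lemma cprimitive_continuous (F f : R -> C) : cprimitive F f -> forall x, continuous F x.
Proof. now intros [H _]. Qed.

Lemma dominated_minus_const (f : R -> C) (c : C) :
  dominated f -> dominated (fun x => f x - c)%C.
Proof.
intros H; apply dominated_plus; [assumption|].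
apply continuous_dominated; intros x; apply continuous_Cconst.
Qed.

(** The equation determines [psi2] at every point. Conversely, the expression it gives is dominated,
    since [V] is dominated and enters only multiplied by the continuous [psi]. *)
Lemma is_sol_iff (V W : R -> C) (lam : R) (psi : R -> C) :
  dominated V -> (forall x, continuous W x) ->
  is_sol V W lam psi <-> exists psi1, solution V W lam psi psi1.
Proof.
intros HV HW; split.
- intros [psi1 [psi2 [H1 [H2 E]]]]; exists psi1.
  apply Cp1_iff in H1, H2; split; [tauto|].
  apply cprimitive_ext with psi1 psi2; [easy| |tauto].
  intros x; specialize (E x).
  replace (psi2 x) with
    (W x * psi1 x + V x * psi x - (- psi2 x + W x * psi1 x + V x * psi x))%C by ring.
  rewrite E; ring.
- intros [psi1 [H1 H2]].
  exists psi1, (fun x => W x * psi1 x + (V x - RtoC lam) * psi x)%C; split; [|split].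
  + apply Cp1_iff; split; [assumption|].
    apply continuous_dominated, (cprimitive_continuous _ _ H2).
  + apply Cp1_iff; split; [assumption|].
    apply dominated_plus.
    * apply continuous_dominated; intros x; apply continuous_Cmult; [apply HW|].
      apply (cprimitive_continuous _ _ H2).
    * apply dominated_ext with (fun x => psi x * (V x - RtoC lam))%C; [intros; ring|].
      apply dominated_mult; [apply (cprimitive_continuous _ _ H1)|].
      now apply dominated_minus_const.
  + intros x; ring.
Qed.

Lemma solution_lin (V W : R -> C) (lam : R) (y y1 u u1 : R -> C) (a b : C) :
  solution V W lam y y1 -> solution V W lam u u1 ->
  solution V W lam (fun x => a * y x + b * u x)%C (fun x => a * y1 x + b * u1 x)%C.
Proof.
intros [H1 H2] [H3 H4].
assert (K : forall F f G h, cprimitive F f -> cprimitive G h ->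
  cprimitive (fun x => a * F x + b * G x)%C (fun x => a * f x + b * h x)%C).
{ intros F f G h HF HG; apply cprimitive_ext with (fun x => a * F x + b * G x)%C
    (fun x => (RtoC 0 * F x + a * f x) + (RtoC 0 * G x + b * h x))%C;
    [easy|intros; ring|].
  apply cprimitive_plus; apply (cprimitive_mult (fun _ => _)); auto using cprimitive_const. }
split; [now apply K|].
refine (cprimitive_ext _ _ _ _ (fun _ => eq_refl) _ (K _ _ _ _ H2 H4)); intros; simpl; ring.
Qed.

Lemma solution_shift (V W : R -> C) (lam g : R) (y y1 : R -> C) :
  periodic g V -> periodic g W -> solution V W lam y y1 ->
  solution V W lam (fun x => y (x + g)) (fun x => y1 (x + g)).
Proof.
intros HV HW [H1 H2]; split; [now apply cprimitive_shift|].
refine (cprimitive_ext _ _ _ _ (fun _ => eq_refl) _ (cprimitive_shift _ _ g H2)).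
intros x; simpl; now rewrite HV, HW.
Qed.

Lemma dominated_Cmod (f : R -> C) : dominated f -> dominated (fun x => RtoC (Cmod (f x))).
Proof.
intros H x; destruct (H x) as [Phi [phi [C1 H1]]]; exists Phi, phi; split; [assumption|].
revert H1; apply filter_imp; intros y [K1 [K2 K3]]; split; [|split]; try assumption.
- now apply continuous_RtoC, continuous_Cmod.
- rewrite Cmod_R, Rabs_pos_eq; [assumption|apply Cmod_ge_0].
Qed.

Lemma Re_mult_conj (z : C) : Re (z * Cconj z) = Cmod z ^ 2.
Proof. now rewrite <- Cmod2_conj. Qed.

(* Gronwall: with [c = 1 + 2|W| + |V - lam|] the energy [N = |y|^2 + |y'|^2] satisfies
   [|N'| <= c N], so [N exp (int c)] increases and [N exp (- int c)] decreases. *)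
Lemma solution_unique (V W : R -> C) (lam : R) (y y1 : R -> C) (x0 : R) :
  dominated V -> (forall x, continuous W x) -> solution V W lam y y1 ->
  y x0 = RtoC 0 -> y1 x0 = RtoC 0 -> forall x, y x = RtoC 0 /\ y1 x = RtoC 0.
Proof.
intros HV HW [H1 H2] E0 E1.
pose (y2 := fun x => (W x * y1 x + (V x - RtoC lam) * y x)%C).
pose (c := fun x => 1 + 2 * Cmod (W x) + Cmod (V x - RtoC lam)).
destruct (dominated_has_cprimitive (fun x => RtoC (c x))) as [Fc [CF DF]].
{ apply dominated_ext with
    (fun x => (RtoC 1 + RtoC 2 * RtoC (Cmod (W x))) + RtoC (Cmod (V x - RtoC lam)))%C.
  { intros x; unfold c; now rewrite !RtoC_plus, RtoC_mult. }
  apply dominated_plus; [|now apply dominated_Cmod, dominated_minus_const].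
  apply continuous_dominated; intros x; apply continuous_Cplus; [apply continuous_Cconst|].
  apply continuous_Cmult; [apply continuous_Cconst|].
  now apply continuous_RtoC, continuous_Cmod. }
destruct (cprimitive_plus _ _ _ _ (cprimitive_mult _ _ _ _ H1 (cprimitive_conj _ _ H1))
  (cprimitive_mult _ _ _ _ H2 (cprimitive_conj _ _ H2))) as [CN DN].
pose (N := fun x => Re (y x * Cconj (y x) + y1 x * Cconj (y1 x))).
pose (n := fun x => Re (y1 x * Cconj (y x) + y x * Cconj (y1 x) +
  (y2 x * Cconj (y1 x) + y1 x * Cconj (y2 x)))).
pose (F := fun x => Re (Fc x)).
assert (NE : forall x, N x = Cmod (y x) ^ 2 + Cmod (y1 x) ^ 2).
{ intros x; unfold N; now rewrite re_plus, !Re_mult_conj. }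
(* With p, q, w, v the moduli of [y], [y1], [W] and [V - lam], the left side is at most 2pq + 2q(wq
   + vp). The bound 2pq <= p^2 + q^2, used with factors 1 and v, yields the coefficient 1 + 2w +
   v. *)
assert (Hn : forall x, Rabs (n x) <= c x * N x).
{ intros x; rewrite NE; unfold n, c.
  eapply Rle_trans; [apply re_le_Cmod|].
  eapply Rle_trans; [apply Cmod_triangle|].
  assert (B2 : Cmod (y2 x) <= Cmod (W x) * Cmod (y1 x) + Cmod (V x - RtoC lam) * Cmod (y x)).
  { unfold y2; eapply Rle_trans; [apply Cmod_triangle|]; rewrite !Cmod_mult; lra. }
  assert (B3 := Cmod_triangle (y1 x * Cconj (y x)) (y x * Cconj (y1 x))).
  assert (B4 := Cmod_triangle (y2 x * Cconj (y1 x)) (y1 x * Cconj (y2 x))).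
  rewrite !Cmod_mult, !Cmod_conj in B3, B4.
  revert B2 B3 B4.
  generalize (Cmod_ge_0 (y x)), (Cmod_ge_0 (y1 x)), (Cmod_ge_0 (W x)),
    (Cmod_ge_0 (V x - RtoC lam)).
  generalize (Cmod (y x)), (Cmod (y1 x)), (Cmod (W x)), (Cmod (V x - RtoC lam)), (Cmod (y2 x)).
  intros p q w v z Hp Hq Hw Hv B2 B3 B4.
  assert (q * z <= q * (w * q + v * p)) by (apply Rmult_le_compat_l; assumption).
  assert (0 <= w * p ^ 2) by (apply Rmult_le_pos; [assumption|apply pow2_ge_0]).
  assert (0 <= v * (p - q) ^ 2) by (apply Rmult_le_pos; [assumption|apply pow2_ge_0]).
  generalize (pow2_ge_0 (p - q)); intros; nra. }
assert (DNF : forall x, locally' x (fun z => is_derive N z (n z) /\ is_derive F z (c z))).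
{ intros x; generalize (filter_and _ _ (DN x) (DF x)); apply filter_imp.
  intros z [[K1 _] [K2 _]]; split; assumption. }
assert (CF' : forall x, continuous F x) by (intros x; now apply continuous_Re).
assert (CN' : forall x, continuous N x) by (intros x; apply (continuous_Re _ _ (CN x))).
assert (N0 : N x0 = 0).
{ rewrite NE, E0, E1, Cmod_0; ring. }
assert (NZ : forall x, N x = 0).
{ intros x; apply Rle_antisym;
    [|rewrite NE; generalize (pow2_ge_0 (Cmod (y x))), (pow2_ge_0 (Cmod (y1 x))); lra].
  destruct (Rle_or_lt x x0) as [Hx|Hx].
  - assert (K : N x * exp (F x) <= N x0 * exp (F x0)).
    { apply (punctured_derive_nonneg_le (fun t => N t * exp (F t)) x x0); try lra.
      - intros t; apply (continuous_mult (K := R_AbsRing)); [apply CN'|].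
        apply (continuous_comp (V := R_UniformSpace)); [apply CF'|apply continuous_exp].
      - intros t; generalize (DNF t); apply filter_imp; intros z [K1 K2] _.
        exists ((n z + c z * N z) * exp (F z)); split.
        + apply Rmult_le_pos; [|apply Rlt_le, exp_pos].
          generalize (proj1 (Rabs_le_between _ _) (Hn z)); lra.
        + solve_derive; ring. }
    rewrite N0, Rmult_0_l in K.
    apply Rmult_le_reg_r with (exp (F x)); [apply exp_pos|lra].
  - assert (K : - N x0 * exp (- F x0) <= - N x * exp (- F x)).
    { apply (punctured_derive_nonneg_le (fun t => - N t * exp (- F t)) x0 x); try lra.
      - intros t; apply (continuous_mult (K := R_AbsRing)).
        + apply (continuous_opp (V := R_NormedModule)), CN'.
        + apply (continuous_comp (V := R_UniformSpace)); [|apply continuous_exp].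
          apply (continuous_opp (V := R_NormedModule)), CF'.
      - intros t; generalize (DNF t); apply filter_imp; intros z [K1 K2] _.
        exists ((- n z + c z * N z) * exp (- F z)); split.
        + apply Rmult_le_pos; [|apply Rlt_le, exp_pos].
          generalize (proj1 (Rabs_le_between _ _) (Hn z)); lra.
        + solve_derive; ring. }
    rewrite N0, Ropp_0, Rmult_0_l in K.
    apply Rmult_le_reg_r with (exp (- F x)); [apply exp_pos|lra]. }
intros x; generalize (NZ x); rewrite NE; intros HN.
generalize (pow2_ge_0 (Cmod (y x))), (pow2_ge_0 (Cmod (y1 x))); intros P1 P2.
split; apply Cmod_eq_0; apply Rsqr_0_uniq; unfold Rsqr; nra.
Qed.

(** Off the exceptional points [f] is a derivative of the zero function. At an exceptional point, a
    nonzero value of [f] would persist nearby by continuity. *)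
Lemma cprimitive_of_zero (F f : R -> C) :
  (forall x, F x = RtoC 0) -> (forall x, continuous f x) -> cprimitive F f ->
  forall x, f x = RtoC 0.
Proof.
intros HF Hf [_ H] x.
apply Classical_Prop.NNPP; intros Hx.
assert (Hr : at_right x (fun z => f z = RtoC 0)).
{ generalize (proj2 (proj1 (locally'_sides _ _) (H x))); apply filter_imp; intros z Hz.
  assert (K : cderive (fun _ => RtoC 0) z (f z)).
  { revert Hz; apply cderive_ext_loc; now apply filter_forall. }
  destruct K as [K1 K2]; apply C_eq.
  - rewrite <- (is_derive_unique _ _ _ K1); apply Derive_const.
  - rewrite <- (is_derive_unique _ _ _ K2); apply Derive_const. }
assert (Hn : locally x (fun z => 0 < Cmod (f z))).
{ apply (continuous_Cmod _ _ (Hf x) (fun r => 0 < r)).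
  apply (open_gt 0); now apply Cmod_gt_0. }
assert (Hn' : at_right x (fun z => 0 < Cmod (f z))).
{ unfold at_right, within; revert Hn; apply filter_imp; auto. }
destruct (filter_ex (F := at_right x) _ (filter_and _ _ Hr Hn')) as [z [Hz1 Hz2]].
rewrite Hz1, Cmod_0 in Hz2; lra.
Qed.

(** * Wronskians and Liouville's formula *)

(** The terms with [V] and [lam] cancel, so the singular coefficient disappears. *)
Lemma wronskian_cprimitive (V W : R -> C) (lam : R) (y y1 u u1 : R -> C) :
  solution V W lam y y1 -> solution V W lam u u1 ->
  cprimitive (fun x => y x * u1 x - y1 x * u x)%C
            (fun x => W x * (y x * u1 x - y1 x * u x))%C.
Proof.
intros [H1 H2] [H3 H4].
refine (cprimitive_ext _ _ _ _ _ _ (cprimitive_plus _ _ _ _ (cprimitive_mult _ _ _ _ H1 H4)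
  (cprimitive_mult _ _ _ _ (cprimitive_const (- RtoC 1)%C) (cprimitive_mult _ _ _ _ H2 H3))));
  intros x; simpl; ring.
Qed.

Lemma cexp_plus (a b : C) : cexp (a + b) = (cexp a * cexp b)%C.
Proof.
unfold cexp; apply C_eq; rewrite ?re_mult, ?im_mult; simpl;
  change (fst (a + b)%C) with (Re a + Re b); change (snd (a + b)%C) with (Im a + Im b);
  change (fst a) with (Re a); change (fst b) with (Re b);
  change (snd a) with (Im a); change (snd b) with (Im b);
  rewrite exp_plus, ?cos_plus, ?sin_plus; ring.
Qed.

Lemma cexp_0 : cexp (RtoC 0) = RtoC 1.
Proof. unfold cexp; apply C_eq; simpl; rewrite exp_0, ?cos_0, ?sin_0; ring. Qed.

Lemma cexp_neq_0 (a : C) : cexp a <> RtoC 0.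
Proof.
intros H; apply C1_nz.
rewrite <- cexp_0; replace (RtoC 0) with (a + - a)%C at 1 by ring.
rewrite cexp_plus, H; ring.
Qed.

Lemma cprimitive_RInt (W : R -> C) : (forall x, continuous W x) ->
  cprimitive (fun x => RInt (V := C_R_CompleteNormedModule) W 0 x) W.
Proof.
intros HW.
assert (D : forall x, cderive (fun x => RInt (V := C_R_CompleteNormedModule) W 0 x) x (W x)).
{ intros x; apply is_derive_C, (is_derive_RInt (V := C_R_NormedModule) W _ 0 x); [|apply HW].
  apply filter_forall; intros z; apply (RInt_correct (V := C_R_CompleteNormedModule)).
  apply (ex_RInt_continuous (V := C_R_CompleteNormedModule)); intros t _; apply HW. }
split.
- intros x; apply (cderive_continuous _ _ _ (D x)).
- intros x; now apply filter_forall.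
Qed.

(** Integrating factor: with [E x] the integral of [W] from 0 to [x], the product of [w] and
    [cexp (- E)] is constant, and [E g] is [g] times the mean of [W]. *)
Lemma liouville (W w : R -> C) (g : R) : 0 < g -> (forall x, continuous W x) ->
  cprimitive w (fun x => W x * w x)%C -> w g = (w 0%R * cexp (RtoC g * Wbar g W))%C.
Proof.
intros Hg HW Hw.
pose (E := (fun x => RInt (V := C_R_CompleteNormedModule) W 0 x) : R -> C).
assert (HE : cprimitive (fun x => - RtoC 1 * E x)%C (fun x => - W x)%C).
{ assert (HE : cprimitive E W) by now apply cprimitive_RInt.
  refine (cprimitive_ext _ _ _ _ _ _ (cprimitive_mult _ _ _ _ (cprimitive_const (- RtoC 1)%C)
    HE)); intros x; simpl; ring. }
assert (K : (w g * cexp (- RtoC 1 * E g) = w 0%R * cexp (- RtoC 1 * E 0%R))%C).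
{ refine (cprimitive_zero_const _ _ _ (cprimitive_mult _ _ _ _ Hw (cprimitive_cexp _ _ HE)) g 0).
  intros x; simpl; ring. }
assert (E0 : E 0 = RtoC 0) by (apply (RInt_point (V := C_R_CompleteNormedModule))).
assert (Eg : (RtoC g * Wbar g W)%C = E g).
{ unfold Wbar; fold (E g); rewrite RtoC_inv by lra; field.
  intros H; apply RtoC_inj in H; lra. }
rewrite E0 in K; replace (- RtoC 1 * RtoC 0)%C with (RtoC 0) in K by ring.
rewrite cexp_0, Cmult_1_r in K; rewrite <- K, Eg, <- Cmult_assoc, <- cexp_plus.
replace (- RtoC 1 * E g + E g)%C with (RtoC 0) by ring.
rewrite cexp_0; ring.
Qed.

(** * A second independent solution and the dimension of the solution space *)

Lemma Cmult_cancel_l (c a b : C) : c <> RtoC 0 -> (c * a = c * b)%C -> a = b.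
Proof.
intros Hc H; replace a with (/ c * (c * a))%C by (field; assumption).
rewrite H; field; assumption.
Qed.

Lemma energy_neq_0 (a b : C) : a <> RtoC 0 \/ b <> RtoC 0 ->
  (a * Cconj a + b * Cconj b)%C <> RtoC 0.
Proof.
intros H E; apply (f_equal Re) in E; rewrite re_plus, !Re_mult_conj in E; simpl Re in E.
destruct H as [H|H]; apply Cmod_gt_0 in H;
  generalize (pow2_ge_0 (Cmod a)), (pow2_ge_0 (Cmod b)); nra.
Qed.

Lemma solution_never_0 (V W : R -> C) (lam : R) (y y1 : R -> C) :
  dominated V -> (forall x, continuous W x) -> solution V W lam y y1 -> Defs.nonzero y ->
  forall x, y x <> RtoC 0 \/ y1 x <> RtoC 0.
Proof.
intros HV HW Hy [x1 H1] x; apply Classical_Prop.NNPP; intros H.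
apply H1, (solution_unique V W lam y y1 x HV HW Hy);
  apply Classical_Prop.NNPP; tauto.
Qed.

Ltac continuity_C :=
  lazymatch goal with
  | |- continuous (fun _ => Cplus _ _) _ => apply continuous_Cplus; continuity_C
  | |- continuous (fun _ => Cminus _ _) _ =>
      apply continuous_Cplus; [|apply continuous_Copp]; continuity_C
  | |- continuous (fun _ => Cmult _ _) _ => apply continuous_Cmult; continuity_C
  | |- continuous (fun _ => Copp _) _ => apply continuous_Copp; continuity_C
  | |- continuous (fun _ => Cconj _) _ => apply continuous_Cconj; continuity_C
  | |- _ => first [apply continuous_Cconst|now trivial]
  end.

(* Reduction of order in the orthogonal frame [(y, y1)], [(- conj y1, conj y)]: unlike the
   classical [y * int (w / y^2)] this is not singular at the zeros of [y].  The coefficient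
   [b = w / N] along the second vector is forced by the Wronskian, and the coefficient [a]
   along the first one is then a primitive. *)
Lemma second_solution (V W : R -> C) (lam : R) (y y1 : R -> C) :
  dominated V -> (forall x, continuous W x) -> solution V W lam y y1 -> Defs.nonzero y ->
  exists u u1, solution V W lam u u1 /\ (y 0 * u1 0 - y1 0 * u 0)%C <> RtoC 0.
Proof.
intros HV HW Hy Hnz.
pose (q := fun x => (V x - RtoC lam)%C).
assert (Hq : dominated q) by now apply dominated_minus_const.
assert (Hqb : dominated (fun x => Cconj (q x))).
{ intros x; destruct (Hq x) as [Phi [phi [C1 H1]]]; exists Phi, phi; split; [assumption|].
  revert H1; apply filter_imp; intros z [K1 [K2 K3]]; split; [|split]; try assumption.
  - now apply continuous_Cconj.
  - now rewrite Cmod_conj. }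
assert (HN : forall x, (y x * Cconj (y x) + y1 x * Cconj (y1 x))%C <> RtoC 0).
{ intros x; apply energy_neq_0, (solution_never_0 V W lam); assumption. }
pose (N := fun x => (y x * Cconj (y x) + y1 x * Cconj (y1 x))%C).
destruct Hy as [H1 H2].
destruct (dominated_has_cprimitive W (continuous_dominated _ HW)) as [E HE].
assert (PN := cprimitive_plus _ _ _ _ (cprimitive_mult _ _ _ _ H1 (cprimitive_conj _ _ H1))
  (cprimitive_mult _ _ _ _ H2 (cprimitive_conj _ _ H2))).
(* Since [E] is a primitive of [W], the nowhere vanishing function [cexp E] obeys the equation of
   the Wronskian and is taken as [w]. *)
assert (Pb := cprimitive_mult _ _ _ _ (cprimitive_cexp _ _ HE) (cprimitive_inv _ _ HN PN)).
pose (b := fun x => (cexp (E x) * / N x)%C).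
assert (Cy := cprimitive_continuous _ _ H1); assert (Cy1 := cprimitive_continuous _ _ H2).
assert (Cb : forall x, continuous b x) by exact (cprimitive_continuous _ _ Pb).
pose (c := fun x => (b x * / N x)%C).
assert (Cc : forall x, continuous c x).
{ intros x; apply continuous_Cmult; [apply Cb|].
  exact (cprimitive_continuous _ _ (cprimitive_inv _ _ HN PN) x). }
(* Insert the ansatz into the two equations of the system, multiply them by the conjugates of [y]
   and [y1] and add: the derivative of [b] cancels and [N a'] remains. The terms in [q] and its
   conjugate are kept apart because these are merely dominated; the rest is continuous. *)
pose (da := fun x => (c x * (Cconj (y x) * (Cconj (W x) * Cconj (y1 x)) - Cconj (y1 x) * Cconj (y1 x)
    + Cconj (y x) * Cconj (y x) + W x * Cconj (y x) * Cconj (y1 x))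
  + c x * Cconj (y x) * Cconj (y x) * Cconj (q x)
  + - c x * Cconj (y1 x) * Cconj (y1 x) * q x)%C).
assert (Hda : dominated da).
{ unfold da; apply dominated_plus; [apply dominated_plus|].
  - apply continuous_dominated; intros x; continuity_C.
  - apply dominated_mult; [|assumption]; intros x; continuity_C.
  - apply dominated_mult; [|assumption]; intros x; continuity_C. }
destruct (dominated_has_cprimitive da Hda) as [a Ha].
assert (P1 := cprimitive_plus _ _ _ _ (cprimitive_mult _ _ _ _ Ha H1)
  (cprimitive_mult _ _ _ _ (cprimitive_const (- RtoC 1)%C)
    (cprimitive_mult _ _ _ _ Pb (cprimitive_conj _ _ H2)))).
assert (P2 := cprimitive_plus _ _ _ _ (cprimitive_mult _ _ _ _ Ha H2)
    (cprimitive_mult _ _ _ _ Pb (cprimitive_conj _ _ H1))).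
exists (fun x => a x * y x - b x * Cconj (y1 x))%C, (fun x => a x * y1 x + b x * Cconj (y x))%C.
split; [split|].
- refine (cprimitive_ext _ _ _ _ _ _ P1); intros x; unfold b, N.
  + ring.
  + unfold da, c, b, N; fold (q x).
    rewrite Cplus_conj, !Cmult_conj; fold (q x).
    generalize (HN x).
    generalize (y x), (y1 x), (q x), (W x), (a x), (cexp (E x)), (Cconj (y x)),
      (Cconj (y1 x)), (Cconj (q x)), (Cconj (W x)).
    intros; field; assumption.
- refine (cprimitive_ext _ _ _ _ _ _ P2); intros x; unfold b, N.
  + reflexivity.
  + unfold da, c, b, N; fold (q x).
    generalize (HN x).
    generalize (y x), (y1 x), (q x), (W x), (a x), (cexp (E x)).
    intros z z1 p w A e Hz; rewrite ?Cplus_conj, ?Cmult_conj; revert Hz.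
    generalize (Cconj z), (Cconj z1), (Cconj p), (Cconj w).
    intros; field; assumption.
(* The coefficient [a] drops out of the Wronskian, which is [b N], that is [cexp E]. *)
- replace (y 0 * (a 0 * y1 0 + b 0 * Cconj (y 0)) - y1 0 * (a 0 * y 0 - b 0 * Cconj (y1 0)))%C
    with (cexp (E 0)).
  + apply cexp_neq_0.
  + unfold b, N; generalize (HN 0); intros; field; assumption.
Qed.

(** Cramer's rule at 0 gives the coefficients; the remaining difference has zero initial data, so it
    vanishes by uniqueness. *)
Lemma solution_decompose (V W : R -> C) (lam : R) (y y1 u u1 v v1 : R -> C) :
  dominated V -> (forall x, continuous W x) ->
  solution V W lam y y1 -> solution V W lam u u1 -> solution V W lam v v1 ->
  (y 0 * u1 0 - y1 0 * u 0)%C <> RtoC 0 ->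
  exists c d, forall x, v x = (c * y x + d * u x)%C /\ v1 x = (c * y1 x + d * u1 x)%C.
Proof.
intros HV HW Hy Hu Hv Hw.
pose (c := ((v 0 * u1 0 - v1 0 * u 0) / (y 0 * u1 0 - y1 0 * u 0))%C).
pose (d := ((y 0 * v1 0 - y1 0 * v 0) / (y 0 * u1 0 - y1 0 * u 0))%C).
exists c, d; intros x.
assert (Hs := solution_lin _ _ _ _ _ _ _ (RtoC 1) (- RtoC 1)%C Hv
  (solution_lin _ _ _ _ _ _ _ c d Hy Hu)).
destruct (fun A B => solution_unique _ _ _ _ _ 0 HV HW Hs A B x) as [E1 E2].
- unfold c, d; field; assumption.
- unfold c, d; field; assumption.
- split.
  + replace (v x) with (RtoC 1 * v x + - RtoC 1 * (c * y x + d * u x) + (c * y x + d * u x))%C by ring.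
    rewrite E1; ring.
  + replace (v1 x) with (RtoC 1 * v1 x + - RtoC 1 * (c * y1 x + d * u1 x) + (c * y1 x + d * u1 x))%C by ring.
    rewrite E2; ring.
Qed.

(** * Floquet multipliers and quasimomenta *)

Definition multiplier (g : R) (V W : R -> C) (lam : R) (rho : C) : Prop :=
  exists y y1, solution V W lam y y1 /\ Defs.nonzero y /\ forall x, y (x + g) = (rho * y x)%C.

(** The relation for [y] cannot simply be differentiated at exceptional points; instead
    [y1 (x + g) - rho * y1 x] is a continuous function with zero primitive. *)
Lemma multiplier_derivative (g : R) (V W : R -> C) (lam : R) (rho : C) (y y1 : R -> C) :
  solution V W lam y y1 -> (forall x, y (x + g) = (rho * y x)%C) ->
  forall x, y1 (x + g) = (rho * y1 x)%C.
Proof.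
intros [H1 H2] Hy x.
assert (P : cprimitive (fun x => y (x + g)%R + - rho * y x)%C
                       (fun x => y1 (x + g)%R + - rho * y1 x)%C).
{ refine (cprimitive_ext _ _ _ _ _ _ (cprimitive_plus _ _ _ _ (cprimitive_shift _ _ g H1)
    (cprimitive_mult _ _ _ _ (cprimitive_const (- rho)%C) H1))); intros z; simpl; ring. }
assert (C1 := cprimitive_continuous _ _ H2).
replace (y1 (x + g)) with (y1 (x + g)%R + - rho * y1 x + rho * y1 x)%C by ring.
rewrite (fun A B => cprimitive_of_zero _ _ A B P x); [ring| |]; intros z.
- rewrite Hy; ring.
- apply (continuous_Cplus (fun t => y1 (t + g))); [apply continuous_shift, C1|].
  apply continuous_Cmult; [apply continuous_Cconst|apply C1].
Qed.

(* The monodromy matrix in the basis [y, u] is triangular with diagonal [rho, d], and its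
   determinant is given by Liouville's formula. *)
Lemma companion_multiplier (g : R) (V W : R -> C) (lam : R) (rho : C) :
  0 < g -> dominated V -> periodic g V -> (forall x, continuous W x) -> periodic g W ->
  multiplier g V W lam rho ->
  exists d, (rho * d)%C = cexp (RtoC g * Wbar g W) /\ (d = rho \/ multiplier g V W lam d).
Proof.
intros Hg HV HVp HW HWp [y [y1 [Hy [Hnz Hrho]]]].
assert (Hrho1 := multiplier_derivative _ _ _ _ _ _ _ Hy Hrho).
destruct (second_solution V W lam y y1 HV HW Hy Hnz) as [u [u1 [Hu Hw]]].
destruct (solution_decompose V W lam y y1 u u1 _ _ HV HW Hy Hu
  (solution_shift _ _ _ _ _ _ HVp HWp Hu) Hw) as [c [d Hcd]].
exists d.
assert (L := liouville W _ g Hg HW (wronskian_cprimitive _ _ _ _ _ _ _ Hy Hu)); simpl in L.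
assert (Hd : (rho * d)%C = cexp (RtoC g * Wbar g W)).
{ apply (Cmult_cancel_l (y 0 * u1 0 - y1 0 * u 0)%C); [assumption|].
  rewrite <- L; destruct (Hcd 0) as [E1 E2].
  assert (E3 := Hrho 0); assert (E4 := Hrho1 0).
  rewrite Rplus_0_l in E1, E2, E3, E4; rewrite E1, E2, E3, E4; ring. }
split; [assumption|].
destruct (Classical_Prop.classic (d = rho)) as [E|E]; [now left|right].
assert (Hdr : (d - rho)%C <> RtoC 0).
{ intros H; apply E; replace d with (d - rho + rho)%C by ring; rewrite H; ring. }
(* Translation by [g] sends [s y + u] to [(s rho + c) y + d u]; this is [d] times [s y + u] exactly
   when [s (d - rho) = c]. *)
pose (s := (c / (d - rho))%C).
exists (fun x => s * y x + RtoC 1 * u x)%C, (fun x => s * y1 x + RtoC 1 * u1 x)%C.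
assert (Hv := solution_lin _ _ _ _ _ _ _ s (RtoC 1) Hy Hu).
split; [assumption|split].
- apply Classical_Prop.NNPP; intros Hn.
  assert (Z : forall x, (s * y x + RtoC 1 * u x)%C = RtoC 0).
  { intros x; apply Classical_Prop.NNPP; intros Hx; apply Hn; now exists x. }
  assert (Z1 := cprimitive_of_zero _ _ Z (cprimitive_continuous _ _ (proj2 Hv)) (proj1 Hv) 0).
  apply Hw.
  (* Adding a multiple of [y] to [u] does not change the Wronskian with [y], which would therefore
     be zero. *)
  replace (y 0 * u1 0 - y1 0 * u 0)%C with
    (y 0 * (s * y1 0 + RtoC 1 * u1 0) - y1 0 * (s * y 0 + RtoC 1 * u 0))%C by ring.
  rewrite Z, Z1; ring.
- intros x; rewrite Hrho, (proj1 (Hcd x)); unfold s; field; assumption.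
Qed.

(** Were the Wronskian zero at 0, uniqueness would make [u] a multiple of [y], and translation by
    [g] would force the multipliers to agree. With independent solutions, translation multiplies the
    Wronskian by [rho * sigma]. *)
Lemma two_multipliers (g : R) (V W : R -> C) (lam : R) (rho sigma : C) :
  0 < g -> dominated V -> (forall x, continuous W x) ->
  multiplier g V W lam rho -> multiplier g V W lam sigma -> rho <> sigma ->
  (rho * sigma)%C = cexp (RtoC g * Wbar g W).
Proof.
intros Hg HV HW [y [y1 [Hy [Hnz Hrho]]]] [u [u1 [Hu [Hnu Hsigma]]]] Hne.
assert (Hrho1 := multiplier_derivative _ _ _ _ _ _ _ Hy Hrho).
assert (Hsigma1 := multiplier_derivative _ _ _ _ _ _ _ Hu Hsigma).
assert (Hw : (y 0 * u1 0 - y1 0 * u 0)%C <> RtoC 0).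
{ intros H0.
  assert (HN := energy_neq_0 _ _ (solution_never_0 _ _ _ _ _ HV HW Hy Hnz 0)).
  pose (N := (y 0 * Cconj (y 0) + y1 0 * Cconj (y1 0))%C).
  (* Hermitian projection of the data of [u] at 0 onto those of [y], which spares a case distinction
     on which of [y 0] and [y1 0] is nonzero. *)
  pose (c := ((Cconj (y 0) * u 0 + Cconj (y1 0) * u1 0) / N)%C).
  assert (Hs := solution_lin _ _ _ _ _ _ _ (RtoC 1) (- c)%C Hu Hy).
  assert (Z : forall x, (RtoC 1 * u x + - c * y x)%C = RtoC 0).
  { intros x; apply (solution_unique _ _ _ _ _ 0 HV HW Hs).
    - replace (RtoC 1 * u 0 + - c * y 0)%C with
        (- Cconj (y1 0) * (y 0 * u1 0 - y1 0 * u 0) / N)%C by (unfold c, N; field; assumption).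
      rewrite H0; unfold N; field; assumption.
    - replace (RtoC 1 * u1 0 + - c * y1 0)%C with
        (Cconj (y 0) * (y 0 * u1 0 - y1 0 * u 0) / N)%C by (unfold c, N; field; assumption).
      rewrite H0; unfold N; field; assumption. }
  destruct Hnu as [x Hx].
  assert (E := Z x); assert (Eg := Z (x + g)); rewrite Hsigma, Hrho in Eg.
  assert (K : ((rho - sigma) * u x)%C = RtoC 0).
  { replace ((rho - sigma) * u x)%C with
      (rho * (RtoC 1 * u x + - c * y x) - (RtoC 1 * (sigma * u x) + - c * (rho * y x)))%C by ring.
    rewrite E, Eg; ring. }
  revert K; apply Cmult_neq_0; [|assumption]; intros K.
  apply Hne; replace rho with (rho - sigma + sigma)%C by ring; rewrite K; ring. }
assert (L := liouville W _ g Hg HW (wronskian_cprimitive _ _ _ _ _ _ _ Hy Hu)); simpl in L.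
apply (Cmult_cancel_l (y 0 * u1 0 - y1 0 * u 0)%C); [assumption|].
rewrite <- L.
generalize (Hrho 0), (Hrho1 0), (Hsigma 0), (Hsigma1 0); rewrite !Rplus_0_l.
intros -> -> -> ->; ring.
Qed.

(** * Complex logarithms and classes of quasimomenta *)

Lemma cexp_eq_1 (z : C) : cexp z = RtoC 1 -> exists m : Z, z = (RtoC (2 * IZR m * PI) * Ci)%C.
Proof.
intros H.
assert (Hre : exp (Re z) * cos (Im z) = 1) by exact (f_equal Re H).
assert (Him : exp (Re z) * sin (Im z) = 0) by exact (f_equal Im H).
generalize (exp_pos (Re z)); intros Hp.
assert (Hs : sin (Im z) = 0) by (apply Rmult_integral in Him; destruct Him; lra).
assert (Hc : cos (Im z) = 1).
{ generalize (sin2_cos2 (Im z)); unfold Rsqr; rewrite Hs; intros Q; nra. }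
assert (Hr : Re z = 0).
{ rewrite Hc in Hre; apply exp_inv; rewrite exp_0; lra. }
(* The half angle turns cosine 1 into a zero of the sine, hence into an integer multiple of pi. *)
assert (Hh : sin (Im z / 2) = 0).
{ generalize (cos_2a_sin (Im z / 2)); replace (2 * (Im z / 2)) with (Im z) by field.
  rewrite Hc; intros Q; nra. }
apply sin_eq_0_0 in Hh; destruct Hh as [m Hm]; exists m.
apply C_eq; rewrite ?re_mult, ?im_mult; simpl; lra.
Qed.

Lemma cexp_2PI (m : Z) : cexp (RtoC (2 * IZR m * PI) * Ci)%C = RtoC 1.
Proof.
assert (K : forall x, sin x = 0 -> cos (2 * x) = 1 /\ sin (2 * x) = 0).
{ intros x Hx; rewrite cos_2a_sin, sin_2a, Hx; split; ring. }
destruct (K (IZR m * PI)) as [Kc Ks]; [apply sin_eq_0_1; now exists m|].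
unfold cexp; replace (Re (RtoC (2 * IZR m * PI) * Ci)) with 0
  by (rewrite re_mult; simpl; ring).
replace (Im (RtoC (2 * IZR m * PI) * Ci)) with (2 * (IZR m * PI))
  by (rewrite im_mult; simpl; ring).
rewrite Kc, Ks, exp_0; apply C_eq; simpl; ring.
Qed.

Lemma cexp_surjective (z : C) : z <> RtoC 0 -> exists a, cexp a = z.
Proof.
intros Hz; apply Cmod_gt_0 in Hz.
pose (r := Cmod z).
assert (Hr : r * r = Re z * Re z + Im z * Im z).
{ unfold r, Cmod, Re, Im; rewrite sqrt_sqrt; [ring|].
  generalize (pow2_ge_0 (fst z)), (pow2_ge_0 (snd z)); lra. }
fold r in Hz.
assert (Hx : (Re z / r) * (Re z / r) + (Im z / r) * (Im z / r) = 1).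
{ replace (_ + _) with ((Re z * Re z + Im z * Im z) / (r * r)) by (field; lra).
  rewrite <- Hr; field; lra. }
assert (Hb : -1 <= Re z / r <= 1) by (split; nra).
assert (K : exists t, cos t = Re z / r /\ sin t = Im z / r).
(* [acos] covers only the upper half circle; the sign of [Im z] decides whether the angle is
   negated. *)
{ destruct (Rle_or_lt 0 (Im z / r)) as [Hi|Hi].
  - exists (acos (Re z / r)); split; [now apply cos_acos|].
    rewrite sin_acos by assumption; unfold Rsqr.
    replace (1 - _) with (Rsqr (Im z / r)) by (unfold Rsqr; lra).
    now apply sqrt_Rsqr.
  - exists (- acos (Re z / r)); split; [rewrite cos_neg; now apply cos_acos|].
    rewrite sin_neg, sin_acos by assumption; unfold Rsqr.
    replace (1 - _) with (Rsqr (- (Im z / r))) by (unfold Rsqr; lra).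
    rewrite sqrt_Rsqr by lra; ring. }
destruct K as [t [Hc Hs]]; exists (ln r, t).
unfold cexp; simpl Re; simpl Im; rewrite exp_ln, Hc, Hs by assumption.
apply C_eq; simpl; field; lra.
Qed.

Lemma RtoC_neq_0 (r : R) : r <> 0 -> RtoC r <> RtoC 0.
Proof. intros Hr H; now apply Hr, RtoC_inj. Qed.

Lemma cexp_eq_iff (a b : C) :
  cexp a = cexp b <-> exists m : Z, a = (b + RtoC (2 * IZR m * PI) * Ci)%C.
Proof.
split.
- intros H; destruct (cexp_eq_1 (a + - b)%C) as [m Hm].
  + rewrite cexp_plus, H, <- cexp_plus.
    replace (b + - b)%C with (RtoC 0) by ring; apply cexp_0.
  + exists m; rewrite <- Hm; ring.
- intros [m ->]; rewrite cexp_plus, cexp_2PI; ring.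
Qed.

(** The classes modulo [2 PI / g] are the fibres of [k] to [exp (i k g)], so counting classes is
    counting multipliers. *)
Lemma ekx_eq_iff (g : R) (k k' : C) : 0 < g -> ekx k g = ekx k' g <-> congr g k k'.
Proof.
intros Hg; assert (Hg' : RtoC g <> RtoC 0) by (apply RtoC_neq_0; lra).
unfold ekx, congr; rewrite cexp_eq_iff; split; intros [m Hm]; exists m.
- apply (Cmult_cancel_l (RtoC g * Ci)%C); [now apply Cmult_neq_0; [|apply Ci_nz]|].
  replace (RtoC g * Ci * k)%C with (Ci * k * RtoC g)%C by ring; rewrite Hm.
  unfold Rdiv; rewrite (RtoC_mult _ (/ g)), RtoC_inv by lra; field; assumption.
- rewrite Hm.
  unfold Rdiv; rewrite (RtoC_mult _ (/ g)), RtoC_inv by lra; field; assumption.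
Qed.

Lemma ekx_plus (k : C) (x z : R) : ekx k (x + z) = (ekx k x * ekx k z)%C.
Proof. unfold ekx; rewrite <- cexp_plus, RtoC_plus; f_equal; ring. Qed.

Lemma ekx_neq_0 (k : C) (x : R) : ekx k x <> RtoC 0.
Proof. apply cexp_neq_0. Qed.

Lemma ekx_opp (k : C) (x : R) : (ekx k x * ekx (- k) x)%C = RtoC 1.
Proof.
unfold ekx; rewrite <- cexp_plus, <- cexp_0; f_equal; ring.
Qed.

Lemma cprimitive_ekx (k : C) : cprimitive (ekx k) (fun x => Ci * k * ekx k x)%C.
Proof.
assert (P : cprimitive (fun x => Ci * k * RtoC x)%C (fun _ => Ci * k)%C).
{ refine (cprimitive_ext _ _ _ _ _ _ (cprimitive_mult _ _ _ _ (cprimitive_const (Ci * k)%C)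
    cprimitive_id)); intros x; simpl; ring. }
exact (cprimitive_cexp _ _ P).
Qed.

Lemma floquet_difference_solution (g : R) (V W : R -> C) (lam : R) (rho : C) (y y1 chi : R -> C) :
  periodic g V -> periodic g W -> solution V W lam y y1 ->
  (forall x, chi x = y (x + g)%R - rho * y x)%C ->
  exists chi1, solution V W lam chi chi1.
Proof.
intros HV HW Hy Hchi.
destruct (solution_lin _ _ _ _ _ _ _ (RtoC 1) (- rho)%C
  (solution_shift _ _ _ _ _ _ HV HW Hy) Hy) as [H1 H2].
eexists; split.
- refine (cprimitive_ext _ _ _ _ _ (fun _ => eq_refl) H1); intros x; rewrite Hchi; simpl; ring.
- refine (cprimitive_ext _ _ _ _ (fun _ => eq_refl) _ H2); intros x; rewrite Hchi; simpl; ring.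
Qed.

(* In the forms (b) and (c), [psi (x + g) - sigma psi x], with [sigma] the multiplier of [k],
   resp. of the other quasimomentum, is a nonzero Bloch solution with quasimomentum [k]. *)
Lemma quasimom_multiplier (g : R) (V W : R -> C) (lam : R) (k : C) :
  0 < g -> dominated V -> periodic g V -> (forall x, continuous W x) -> periodic g W ->
  quasimom g V W lam k -> multiplier g V W lam (ekx k g).
Proof.
intros Hg HV HVp HW HWp [psi [Hpsi Hform]].
apply is_sol_iff in Hpsi; try assumption; destruct Hpsi as [psi1 Hpsi].
assert (Hc : forall k1 k2, form_c g psi k1 k2 -> multiplier g V W lam (ekx k1 g)).
{ intros k1 k2 [p1 [p2 [[Hp1 _] [[Hp2 _] [[x Hx] [_ [Hne E]]]]]]].
  pose (chi := fun x => ((ekx k1 g - ekx k2 g) * ekx k1 x * p1 x)%C).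
  destruct (floquet_difference_solution g V W lam (ekx k2 g) psi psi1 chi) as [chi1 Hchi];
    try assumption.
  { intros z; unfold chi; rewrite !E, Hp1, Hp2, !ekx_plus; ring. }
  exists chi, chi1; split; [assumption|split].
  - exists x; unfold chi; apply Cmult_neq_0; [apply Cmult_neq_0|assumption].
    + intros H; apply Hne, ekx_eq_iff; [assumption|].
      replace (ekx k1 g) with (ekx k1 g - ekx k2 g + ekx k2 g)%C by ring; rewrite H; ring.
    + apply ekx_neq_0.
  - intros z; unfold chi; rewrite Hp1, ekx_plus; ring. }
destruct Hform as [Hf|[Hf|[k' [Hf|Hf]]]].
- destruct Hf as [p [[Hp _] [[x Hx] E]]].
  exists psi, psi1; split; [assumption|split].
  + exists x; rewrite E; apply Cmult_neq_0; [apply ekx_neq_0|assumption].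
  + intros z; rewrite !E, Hp, ekx_plus; ring.
- destruct Hf as [p1 [p2 [[Hp1 _] [[Hp2 _] [[x Hx] E]]]]].
  (* The periodic parts cancel; of the linear factor only the increment [(x + g) - x = g]
     survives. *)
  pose (chi := fun x => (ekx k g * RtoC g * ekx k x * p2 x)%C).
  destruct (floquet_difference_solution g V W lam (ekx k g) psi psi1 chi) as [chi1 Hchi];
    try assumption.
  { intros z; unfold chi; rewrite !E, Hp1, Hp2, !ekx_plus, RtoC_plus; ring. }
  exists chi, chi1; split; [assumption|split].
  + exists x; unfold chi; repeat apply Cmult_neq_0; try assumption; try apply ekx_neq_0.
    apply RtoC_neq_0; lra.
  + intros z; unfold chi; rewrite Hp2, ekx_plus; ring.
- now apply (Hc k k').
- destruct Hf as [p1 [p2 [A [B [D1 [D2 [F E]]]]]]].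
  apply (Hc k k'); exists p2, p1; repeat (split; [assumption|]); split.
  + intros [m Hm]; apply F; exists (- m)%Z; rewrite Hm, opp_IZR, <- Cplus_assoc, <- RtoC_plus.
    replace (2 * IZR m * PI / g + 2 * - IZR m * PI / g) with 0 by (field; lra); ring.
  + intros x; rewrite E; ring.
Qed.

(** A multiplier always yields form (a), with [p = exp (- i k x) y]. Periodicity is immediate; the
    work lies in the regularity of [p]. *)
Lemma multiplier_quasimom (g : R) (V W : R -> C) (lam : R) (k : C) :
  dominated V -> (forall x, continuous W x) ->
  multiplier g V W lam (ekx k g) -> quasimom g V W lam k.
Proof.
intros HV HW [y [y1 [Hy [[x Hx] Hm]]]].
exists y; split; [apply is_sol_iff; try assumption; now exists y1|left].
pose (e := ekx (- k)); pose (j := (Ci * - k)%C).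
destruct Hy as [H1 H2].
assert (He := cprimitive_ekx (- k)%C); fold e in He; fold j in He.
assert (Pp := cprimitive_mult _ _ _ _ He H1).
assert (Pj : forall c F f, cprimitive F f ->
  cprimitive (fun x => c * F x)%C (fun x => c * f x)%C).
{ intros c F f HF.
  refine (cprimitive_ext _ _ _ _ _ _ (cprimitive_mult _ _ _ _ (cprimitive_const c) HF));
    intros z; simpl; ring. }
assert (Pp1 := cprimitive_plus _ _ _ _ (cprimitive_mult _ _ _ _ (Pj j _ _ He) H1)
  (cprimitive_mult _ _ _ _ He H2)).
assert (Ce := cprimitive_continuous _ _ He).
assert (Cy := cprimitive_continuous _ _ H1); assert (Cy1 := cprimitive_continuous _ _ H2).
exists (fun x => e x * y x)%C; split; [split|split].
- intros z; unfold e; rewrite Hm, ekx_plus.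
  transitivity (ekx (- k) z * y z * (ekx k g * ekx (- k) g))%C; [ring|].
  rewrite ekx_opp; ring.
- eexists; eexists; split; apply Cp1_iff; split.
  + exact Pp.
  + apply continuous_dominated; exact (cprimitive_continuous _ _ Pp1).
  + exact Pp1.
  (* The second derivative of [p] is sorted into a continuous part and one multiple of [V - lam] by
     the continuous [e y]. *)
  + simpl; apply dominated_ext with (fun x => (j * (j * e x) * y x + j * e x * y1 x
      + (j * e x * y1 x + e x * (W x * y1 x))) + e x * y x * (V x - RtoC lam))%C.
    { intros z; ring. }
    apply dominated_plus.
    * apply continuous_dominated; intros z; continuity_C.
    * apply dominated_mult; [|now apply dominated_minus_const].
      intros z; now apply continuous_Cmult.
- exists x; apply Cmult_neq_0; [apply ekx_neq_0|assumption].
- intros z; unfold e; rewrite Cmult_assoc, ekx_opp; ring.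
Qed.

Lemma quasimom_iff (g : R) (V W : R -> C) (lam : R) (k : C) :
  0 < g -> dominated V -> periodic g V -> (forall x, continuous W x) -> periodic g W ->
  quasimom g V W lam k <-> multiplier g V W lam (ekx k g).
Proof.
intros; split; [now apply quasimom_multiplier|now apply multiplier_quasimom].
Qed.

Lemma ekx_surjective (g : R) (z : C) : 0 < g -> z <> RtoC 0 -> exists k, ekx k g = z.
Proof.
intros Hg Hz; destruct (cexp_surjective z Hz) as [a <-].
exists (a / (Ci * RtoC g))%C; unfold ekx; f_equal; field; split;
  [apply RtoC_neq_0; lra|apply Ci_nz].
Qed.

Lemma congr_trans (g : R) (a b c : C) : 0 < g -> congr g a b -> congr g b c -> congr g a c.
Proof. intros Hg H1 H2; apply ekx_eq_iff in H1, H2; try assumption; apply ekx_eq_iff; congruence. Qed.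

(** Taking logarithms gives [k = Wbar / (2 i) + m PI / g] for an integer [m]. Steps of [2 PI / g]
    stay in one class, so only the parity of [m] matters. *)
Lemma ekx_half_mean (g : R) (W : R -> C) (k : C) : 0 < g ->
  (ekx k g * ekx k g)%C = cexp (RtoC g * Wbar g W) ->
  congr g k (Wbar g W / (RtoC 2 * Ci))%C \/
  congr g k (Wbar g W / (RtoC 2 * Ci) + RtoC (PI / g))%C.
Proof.
intros Hg H; unfold ekx in H; rewrite <- cexp_plus in H.
apply cexp_eq_iff in H; destruct H as [m Hm].
assert (Hg' : RtoC g <> RtoC 0) by (apply RtoC_neq_0; lra).
assert (H2 : RtoC 2 <> RtoC 0) by (apply RtoC_neq_0; lra).
assert (Hi := Ci_nz).
assert (Hk : k = (Wbar g W / (RtoC 2 * Ci) + RtoC (IZR m * PI / g))%C).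
{ apply (Cmult_cancel_l (RtoC 2 * Ci * RtoC g)%C); [repeat apply Cmult_neq_0; assumption|].
  replace (RtoC 2 * Ci * RtoC g * k)%C with (Ci * k * RtoC g + Ci * k * RtoC g)%C by ring.
  rewrite Hm; unfold Rdiv; rewrite !RtoC_mult, RtoC_inv by lra; field; split; assumption. }
destruct (Z.Even_or_Odd m) as [[n ->]|[n ->]]; [left|right]; exists n; rewrite Hk.
- do 2 f_equal; rewrite mult_IZR; field; lra.
- rewrite <- Cplus_assoc, <- RtoC_plus; do 2 f_equal; rewrite plus_IZR, mult_IZR; field; lra.
Qed.

Lemma ekx_product_mean (g : R) (W : R -> C) (k1 k2 : C) : 0 < g ->
  (ekx k1 g * ekx k2 g)%C = cexp (RtoC g * Wbar g W) ->
  congr g (k1 + k2)%C (Wbar g W / Ci)%C.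
Proof.
intros Hg H; apply ekx_eq_iff; [assumption|].
replace (ekx (k1 + k2) g) with (ekx k1 g * ekx k2 g)%C
  by (unfold ekx; rewrite <- cexp_plus; f_equal; ring).
rewrite H; unfold ekx; f_equal; field; apply Ci_nz.
Qed.

Theorem theorem3p6 (g : R) (V W : R -> C) (lam : R) :
  0 < g ->
  Cp0 V -> periodic g V ->
  (forall x, continuous W x) -> periodic g W ->
  ((sigma_g1 g V W lam \/ sigma_g2 g V W lam) ->
     A_is_class g V W lam (Wbar g W / (RtoC 2 * Ci))%C \/
     A_is_class g V W lam (Wbar g W / (RtoC 2 * Ci) + RtoC (PI / g))%C) /\
  (sigma_g3 g V W lam ->
     exists k1 k2, ~ congr g k1 k2 /\
       (forall k, quasimom g V W lam k <-> congr g k k1 \/ congr g k k2) /\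
       congr g (k1 + k2)%C (Wbar g W / Ci)%C).
Proof.
intros Hg HV0 HVp HW HWp.
assert (HV := Cp0_dominated V HV0).
assert (Q : forall k, quasimom g V W lam k <-> multiplier g V W lam (ekx k g))
  by (intros k; now apply quasimom_iff).
(* Being a quasimomentum depends only on the class; this supplies the inclusion of whole classes in
   the set of quasimomenta. *)
assert (Qc : forall k k', quasimom g V W lam k' -> congr g k k' -> quasimom g V W lam k).
{ intros k k' H Hc; apply Q in H; apply Q.
  now rewrite (proj2 (ekx_eq_iff g k k' Hg) Hc). }
split.
- intros Hs.
  assert (HA : card_A_1 g V W lam) by (destruct Hs as [[_ H]|[_ H]]; exact H).
  destruct HA as [k [Hk Huniq]].
  destruct (companion_multiplier g V W lam (ekx k g)) as [d [Hd Hm]]; try assumption;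
    [now apply Q|].
  (* The product of [d] with the multiplier is an exponential, so [d] is nonzero and has the form
     [ekx k' g]. If [d] is itself a multiplier, then [k'] is a quasimomentum and uniqueness of the
     class identifies it with [k]. *)
  assert (Ed : d = ekx k g).
  { destruct Hm as [|Hm]; [assumption|].
    destruct (ekx_surjective g d Hg) as [k' Hk'].
    { intros H0; apply (cexp_neq_0 (RtoC g * Wbar g W)); rewrite <- Hd, H0; ring. }
    rewrite <- Hk' in *; apply ekx_eq_iff; [assumption|]; now apply Huniq, Q. }
  rewrite Ed in Hd.
  assert (HA : forall c, congr g k c -> A_is_class g V W lam c).
  { intros c Hc k'; split; intros H.
    - apply congr_trans with k; auto.
    - apply (Qc k' k); [assumption|].
      apply ekx_eq_iff in Hc, H; try assumption; apply ekx_eq_iff; congruence. }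
  destruct (ekx_half_mean g W k Hg Hd); [left|right]; auto.
- intros [_ [k1 [k2 [Hne [H1 [H2 Hall]]]]]].
  exists k1, k2; split; [assumption|split].
  + intros k; split; [apply Hall|]; intros [H|H]; [apply (Qc k k1)|apply (Qc k k2)]; assumption.
  + apply ekx_product_mean; [assumption|].
    apply (two_multipliers g V W lam); try assumption; try now apply Q.
    intros H; apply Hne; now apply ekx_eq_iff.
Qed.
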